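(* For any $\varepsilon>0$ there exists $d_0=d_0(\varepsilon)\ge1$ such that for any $d\ge d_0$ and any $0<\beta\le(1-\varepsilon)\beta_c(d)$ the following holds. Let $\mathbf G=\mathbf G(n,d/n)$ with the Edwards–Anderson model at inverse temperature $\beta$, let $\ell=r=\frac{\log n}{\sqrt d}$, and let $\mathcal S_B$ be the event that every path in $\mathcal P_{r,\ell}(\mathbf G)$ contains a $(d,\varepsilon)$-block vertex of range $r$. Then $\Pr[\mathcal S_B]\ge 1-n^{-d^{10/75}}$.
   Context: $\mathbf{G}(n,d/n)$: random graph on $n$ vertices, edges independent with probability $d/n$; couplings $J_e$ i.i.d. standard Gaussians; $\beta_c(k)=\sqrt{2\pi}/k$. Influence $\Gamma_e=\frac{|1-\exp(\beta J_e)|}{1+\exp(\beta J_e)}$; $\mathcal A(u)=\sum_{w\sim u}\Gamma_{\{u,w\}}$; $M(u)=1-\varepsilon/4$ if $\mathcal A(u)\le1-\varepsilon/2$, else $d\,\mathcal A(u)$; for a path $P$ (distinct vertices, consecutive adjacent; length = number of edges) $M(P)=\prod_{v\in P}M(v)$. For an integer $k\le\log n$, a vertex $u$ is a $(d,\varepsilon)$-block vertex of range $k$ if every path of length at most $k$ starting at $u$ has $M(P)<1$. $N_r(P)$: vertices reachable from a vertex of $P$ by a path of length at most $r$; $P$ is $r$-locally simple if $N_r(P)$ induces a tree; $\mathcal P_{r,\ell}(G)$ is the set of $r$-locally simple paths of length at least $\ell$. *)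

(* Defs.v *)
From HB Require Import structures.
From mathcomp Require Import all_boot all_order all_algebra.
From mathcomp Require Import all_classical all_reals all_analysis.

Set Implicit Arguments.
Unset Strict Implicit.
Unset Printing Implicit Defensive.

Import Order.TTheory GRing.Theory Num.Theory.
Import numFieldNormedType.Exports.

Local Open Scope classical_set_scope.
Local Open Scope ring_scope.

(* A simple graph on V is given by its edge set E, whose members are
   two-element sets. A path v_0, ..., v_l is the pair (v_0, [:: v_1; ...; v_l])
   so its length is the size of the second component. *)
Section graphs.
Context {R : realType} {V : finType} (E : {set {set V}}).

Definition adj : rel V := [rel u v | (u != v) && ([set u; v]%SET \in E)].

Definition is_path (x : V) (s : seq V) : bool := path adj x s && uniq (x :: s).

Definition induced_adj (A : {set V}) : rel V :=
  [rel u v | [&& u \in A, v \in A & adj u v]].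

Definition induces_tree (A : {set V}) : Prop :=
  [/\ A != finset.set0,
      {in A &, forall u v, connect (induced_adj A) u v} &
      forall c : seq V, (2 < size c)%N -> ~~ ucycleb (induced_adj A) c].

Definition nbhd (r : R) (x : V) (s : seq V) : {set V} :=
  [set w | `[< exists v t, [/\ v \in x :: s, is_path v t,
                               last v t = w & (size t)%:R <= r] >]]%SET.

Definition locally_simple (r : R) (x : V) (s : seq V) : Prop :=
  induces_tree (nbhd r x s).

Definition simple_paths (r l : R) : set (V * seq V) :=
  [set p | [/\ is_path p.1 p.2, locally_simple r p.1 p.2 &
               l <= (size p.2)%:R]].

End graphs.

Definition beta_c {R : realType} (k : R) : R := Num.sqrt (2 * pi) / k.

Section block_vertices.
Context {R : realType} {V : finType}.
Variables (d eps beta : R) (E : {set {set V}}) (J : {set V} -> R).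

Definition influence (e : {set V}) : R :=
  `|1 - expR (beta * J e)| / (1 + expR (beta * J e)).

Definition agg_influence (u : V) : R :=
  \sum_(w | adj E u w) influence [set u; w]%SET.

Definition vertex_weight (u : V) : R :=
  if agg_influence u <= 1 - eps / 2 then 1 - eps / 4 else d * agg_influence u.

Definition path_weight (x : V) (s : seq V) : R :=
  \prod_(v <- x :: s) vertex_weight v.

(* The range k is real; only the paths of length at most floor(k) matter. *)
Definition block_vertex (k : R) (u : V) : Prop :=
  forall s : seq V, is_path E u s -> (size s)%:R <= k -> path_weight u s < 1.

End block_vertices.

Section random_model.
Context {disp : measure_display} {T : measurableType disp} {R : realType}.
Variable P : probability T R.

Definition mutually_independent (I : finType) (F : I -> set (set T)) : Prop :=
  forall (S : {set I}) (A : I -> set T), (forall i, i \in S -> F i (A i)) ->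
    P (\bigcap_(i in [set` S]) A i) = (\prod_(i in S) P (A i))%E.

Definition sigma_of d' (T' : measurableType d') (X : T -> T') : set (set T) :=
  preimage_set_system setT X measurable.

Definition vpair (n : nat) := {e : {set 'I_n} | #|e| == 2%N}.

(* X e indicates whether the pair e is an edge and J e is its coupling; the
   couplings are drawn for all pairs, independently of the graph. The values of
   X and J at sets that are not pairs are irrelevant. *)
Definition EA_on_Gnp (n : nat) (p : R) (X : {set 'I_n} -> {RV P >-> bool})
    (J : {set 'I_n} -> {RV P >-> R}) : Prop :=
  [/\ forall (e : vpair n) (B : set bool),
        distribution P (X (val e)) B = bernoulli_prob p B,
      forall (e : vpair n) (B : set R), measurable B ->
        distribution P (J (val e)) B = normal_prob 0 1 B &
      mutually_independent (fun i : vpair n + vpair n =>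
        match i with
        | inl e => sigma_of (X (val e))
        | inr e => sigma_of (J (val e))
        end)].

Definition random_edges (n : nat) (X : {set 'I_n} -> {RV P >-> bool}) (w : T) :
    {set {set 'I_n}} :=
  [set e : {set 'I_n} | (#|e| == 2%N) && X e w]%SET.

Definition event_SB (n : nat) (d eps beta r l : R)
    (X : {set 'I_n} -> {RV P >-> bool}) (J : {set 'I_n} -> {RV P >-> R}) :
    set T :=
  [set w | forall p, simple_paths (random_edges X w) r l p ->
     exists2 u, u \in p.1 :: p.2 &
       block_vertex d eps beta (random_edges X w) (fun e => J e w) r u].

End random_model.

(* Main.v *)
Require Import Defs.
From HB Require Import structures.
From mathcomp Require Import all_boot all_order all_algebra.
From mathcomp Require Import all_classical all_reals all_analysis.
From mathcomp Require Import measurable_realfun zify ring lra.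

Set Implicit Arguments.
Unset Strict Implicit.
Unset Printing Implicit Defensive.

Import Order.TTheory GRing.Theory Num.Theory.
Import numFieldNormedType.Exports.

Local Open Scope classical_set_scope.
Local Open Scope ring_scope.

(* If a locally simple path P has no block vertex, every vertex of P starts a
   short path of weight at least 1. Since the neighbourhood of P is a tree, these
   witnesses leave P at most once; choosing greedily among those that start in
   the more frequent direction yields disjoint witnesses covering at least half
   of P. Together with P they form a caterpillar: a tree with N vertices of
   which at least N/2 (the "selected" ones) have product of weights at least 1.

   A fixed caterpillar with N vertices is an induced subgraph with probability
   at most (d/n)^(N-1), and there are at most (4n)^N of them. By Markov's
   inequality applied to the m-th power of the product of the weights, with
   d = z^16 and m about z^14, each selected vertex contributes a factor
   exp(-c z^14): light vertices have weight 1 - eps/4, and a heavy vertex has a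
   large deviation of its aggregate influence, whose mean is at most 1 - eps and
   whose exponential moments come from E|J| = sqrt(2/pi). The edges of the tree
   shared by two vertices cost only a constant factor each. Summing over
   N >= log n / sqrt d gives n^(-z^4) <= n^(-d^(10/75)).

   Influences are rounded up to multiples of 1/K, so that all expectations are
   finite sums over configurations. *)

(** If the first steps differ, the piece of [p] up to its first vertex [z] on [q], followed by the
    piece of [q] from [z] back to [x], closes a cycle. A common first step is removed by
    induction. *)
Lemma acyclic_path_unique (V : finType) (e : rel V) :
  symmetric e -> (forall c, (2 < size c)%N -> ~~ ucycleb e c) ->
  forall x p q, path e x p -> uniq (x :: p) -> path e x q -> uniq (x :: q) ->
  last x p = last x q -> p = q.
Proof.
move=> esym acyc x p; elim: p x => [|a p IH] x q.
  case: q => [|b q] //= _ _ _ /andP[xq _] lx.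
  by move: (mem_last b q); rewrite -lx (negbTE xq).
case: q => [|b q].
  move=> /= _ /andP[xq _] _ _ lx.
  by move: (mem_last a p); rewrite lx (negbTE xq).
have [<-|nab] := eqVneq a b.
  rewrite /= => /andP[_ pp] /andP[_ up] /andP[_ pq] /andP[_ uq] lpq.
  by congr cons; exact: (IH a).
move=> pp up pq uq lpq; exfalso.
have hp : has (mem (b :: q)) (a :: p).
  apply/hasP; exists (last a p); first exact: mem_last.
  by rewrite inE [last a p]lpq; exact: (mem_last b q).
have [z [p1 [p2 [zq np Ep]]]] : exists z p1 p2,
    [/\ z \in b :: q, ~~ has (mem (b :: q)) p1 & a :: p = p1 ++ z :: p2].
  by case: (split_find hp) => z p1 p2 zq np; exists z, p1, p2; rewrite cat_rcons.
case/splitPr Eq: (b :: q) / zq => [q1 q2].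
rewrite Eq in pq uq np; rewrite Ep in pp up.
have [] := negP (acyc (x :: p1 ++ z :: rev q1) _).
  (* The cycle has fewer than three vertices only if both pieces are empty; then [z] would equal
     both [a] and [b]. *)
  rewrite /= size_cat /= size_rev; case: p1 q1 Ep Eq {pp up pq uq np} => [|? ?] [|? ?] /=;
    try by move=> *; lia.
  by move=> [Ea _] [Eb _]; rewrite Ea Eb eqxx in nab.
apply/andP; split.
  move: pp pq; rewrite /= !cat_path /= => /and3P[pp1 pz _] /and3P[pq1 qz _].
  rewrite rcons_cat cat_path pp1 rcons_cons /= pz /=.
  rewrite -rev_cons -(belast_rcons x q1 z) -{1}(last_rcons x q1 z) rev_path.
  by rewrite (eq_path (e' := e)) ?rcons_path ?pq1.
move: up uq np; rewrite /= !cat_uniq !mem_cat /= ?in_cons ?mem_rev rev_uniq.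
move=> /andP[/norP[xp1 /norP[xz _]] /and3P[-> /norP[zp1 _] _]].
move=> /andP[/norP[xq1 _] /and3P[-> /norP[zq1 _] _]].
move=> /hasPn np.
rewrite (negbTE xp1) (negbTE xz) (negbTE xq1) (negbTE zp1) zq1 /= andbT.
apply/hasPn => y; rewrite mem_rev => yq1; apply/negP => yp1.
by have := np _ yp1; rewrite inE mem_cat yq1.
Qed.

(** * Caterpillars coded as sequences of items, and their edges *)

Section caterpillars.
Variable V : finType.

(* [(v, (h, q))]: a vertex v, hanging off the previous item if [h] and
   continuing the spine otherwise; [q] selects v for the weight estimate. *)
Definition item : finType := (V * (bool * bool))%type.
Implicit Types (i : item) (t : seq item) (p x v y : V).

Definition hanging i := i.2.1.
Definition selected i := i.2.2.
Definition verts t : seq V := [seq i.1 | i <- t].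

(** [p] is the vertex of the previous item and [x] the last spine vertex: a hanging item prolongs
    the branch at [p], a spine item resumes at [x]. The edges are thus read off from the items
    alone, and on n vertices there are only 4n items, whence the count (4n)^N. *)
Fixpoint item_edges p x t : seq {set V} :=
  if t is i :: t' then
    if hanging i then [set p; i.1]%SET :: item_edges i.1 x t'
    else [set x; i.1]%SET :: item_edges i.1 i.1 t'
  else [::].

Definition cat_edges t : seq {set V} :=
  if t is i :: t' then item_edges i.1 i.1 t' else [::].

Definition last_spine x t : V := foldl (fun x i => if hanging i then x else i.1) x t.

Lemma item_edges_cat p x t1 t2 :
  item_edges p x (t1 ++ t2) =
  item_edges p x t1 ++ item_edges (last p (verts t1)) (last_spine x t1) t2.
Proof.
by elim: t1 p x => [|i t1 IH] p x //=; case: ifP => _; rewrite IH.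
Qed.

Lemma size_cat_edges t : size (cat_edges t) = (size t).-1.
Proof.
case: t => // i t /=; move: (i.1) {1}(i.1) => p x.
by elim: t p x => [|j t IH] p x //=; case: ifP => _ /=; rewrite IH.
Qed.

Lemma item_edges_sub p x t e :
  e \in item_edges p x t -> forall y, y \in e -> y \in [:: p, x & verts t].
Proof.
elim: t p x => [|i t IH] p x //=.
case: ifP => _; rewrite inE => /orP[/eqP->|/IH sub] y.
- by rewrite !inE => /orP[]->; rewrite ?orbT.
- by move=> /sub; rewrite !inE => /or3P[]->; rewrite ?orbT.
- by rewrite !inE => /orP[]->; rewrite ?orbT.
- by move=> /sub; rewrite !inE => /or3P[]->; rewrite ?orbT.
Qed.

Lemma item_edges_meet p x t e :
  e \in item_edges p x t -> exists2 y, y \in verts t & y \in e.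
Proof.
elim: t p x => [|i t IH] p x //=.
case: ifP => _; rewrite inE => /orP[/eqP->|/IH[y yt ye]].
- by exists i.1; rewrite !inE eqxx ?orbT.
- by exists y; rewrite // inE yt orbT.
- by exists i.1; rewrite !inE eqxx ?orbT.
- by exists y; rewrite // inE yt orbT.
Qed.

(** Each item joins its new vertex to an earlier one, whereas every later edge contains the vertex
    of a later item. *)
Lemma item_edges_uniq p x t :
  uniq (verts t) -> p \notin verts t -> x \notin verts t ->
  uniq (item_edges p x t) /\ {in item_edges p x t, forall e : {set V}, #|e| = 2%N}.
Proof.
elim: t p x => [|i t IH] p x //= /andP[it ut].
rewrite !inE !negb_or => /andP[pi pt] /andP[xi xt].
have fresh q : q \notin verts t -> q != i.1 -> forall u w,
    u \in [:: i.1; x] -> w \in [:: i.1; x] ->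
    [set q; i.1]%SET \notin item_edges u w t.
  move=> qt qi u w uix wix; apply/negP => /item_edges_meet[y yt].
  rewrite !inE => /orP[]/eqP Ey; subst y; first by rewrite yt in qt.
  by rewrite yt in it.
case: ifP => _; rewrite /=.
  have [u1 u2] := IH i.1 x ut it xt.
  split; first by rewrite u1 andbT; apply: fresh; rewrite // !inE eqxx ?orbT.
  by move=> e; rewrite inE => /orP[/eqP->|/u2//]; rewrite cards2 pi.
have [u1 u2] := IH i.1 i.1 ut it it.
split; first by rewrite u1 andbT; apply: fresh; rewrite // !inE eqxx ?orbT.
by move=> e; rewrite inE => /orP[/eqP->|/u2//]; rewrite cards2 xi.
Qed.

Lemma cat_edges_uniq t : uniq (verts t) ->
  uniq (cat_edges t) /\ {in cat_edges t, forall e : {set V}, #|e| = 2%N}.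
Proof. by case: t => // i t /= /andP[it ut]; exact: item_edges_uniq. Qed.

Definition cat_adj t : rel V := [rel u v | [set u; v]%SET \in cat_edges t].

Lemma cat_adj_sym t : symmetric (cat_adj t).
Proof. by move=> u v; rewrite /cat_adj /= finset.setUC. Qed.

Lemma item_edges_connect (r : rel V) p x t z :
  (forall u v, [set u; v]%SET \in item_edges p x t -> r u v) ->
  connect r z p -> connect r z x -> {in verts t, forall u, connect r z u}.
Proof.
elim: t p x => [|i t IH] p x //= rt zp zx u.
case: ifP rt => _ rt; rewrite inE => /orP[/eqP->|ut].
- by apply: connect_trans zp (connect1 _); apply: rt; rewrite inE eqxx.
- apply: (IH i.1 x) => // [a b ab|]; first by apply: rt; rewrite inE ab orbT.
  by apply: connect_trans zp (connect1 _); apply: rt; rewrite inE eqxx.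
- by apply: connect_trans zx (connect1 _); apply: rt; rewrite inE eqxx.
- apply: (IH i.1 i.1) => // [a b ab||]; first by apply: rt; rewrite inE ab orbT.
  + by apply: connect_trans zx (connect1 _); apply: rt; rewrite inE eqxx.
  + by apply: connect_trans zx (connect1 _); apply: rt; rewrite inE eqxx.
Qed.

Lemma cat_connect t : {in verts t &, forall u v, connect (cat_adj t) u v}.
Proof.
case: t => // i t u v ut vt.
have c : {in verts (i :: t), forall w, connect (cat_adj (i :: t)) i.1 w}.
  move=> w; rewrite inE => /orP[/eqP->|]; first exact: connect0.
  exact: (item_edges_connect (p := i.1) (x := i.1)).
apply: connect_trans (c _ vt).
by rewrite (sym_connect_sym (@cat_adj_sym _)) c.
Qed.

Definition spine (q : bool) (s : seq V) : seq item := [seq (v, (false, q)) | v <- s].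
Definition hang (s : seq V) : seq item := [seq (v, (true, true)) | v <- s].

Lemma verts_spine q s : verts (spine q s) = s.
Proof. by rewrite /verts -map_comp map_id. Qed.

Lemma verts_hang s : verts (hang s) = s.
Proof. by rewrite /verts -map_comp map_id. Qed.

Lemma last_spine_spine q x s : last_spine x (spine q s) = last x s.
Proof. by elim: s x => //=. Qed.

Lemma item_edges_spine q q' p x s : item_edges p x (spine q s) = item_edges p x (spine q' s).
Proof. by elim: s p x => //= v s IH p x; rewrite (IH v v). Qed.

Lemma last_spine_hang x s : last_spine x (hang s) = x.
Proof. by elim: s x => //=. Qed.

Definition starts_spine t := if t is i :: _ then ~~ hanging i else true.

Lemma item_edges_starts p p' x t :
  starts_spine t -> item_edges p x t = item_edges p' x t.
Proof. by case: t => //= i t /negbTE->. Qed.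

(** Used to hang a witness [z] at [v]. Hanging items do not change the last spine vertex and [t]
    starts on the spine, so the old edges survive. Edges do not depend on selection, so the prefix
    may be reflagged in two blocks. *)
Lemma cat_edges_insert q s q1 s1 q2 s2 v z t : s ++ [:: v] = s1 ++ s2 ->
  starts_spine t ->
  cat_edges (spine q1 s1 ++ spine q2 s2 ++ hang z ++ t) =i
  cat_edges (spine q (rcons s v) ++ t) ++ item_edges v v (hang z).
Proof.
move=> Es st e.
have -> : cat_edges (spine q1 s1 ++ spine q2 s2 ++ hang z ++ t) =
          cat_edges (spine q (rcons s v) ++ hang z ++ t).
  rewrite -cats1 Es /spine map_cat -catA.
  case: s1 Es => [|a s1] Es /=.
    case: s2 Es => [|b s2] Es /=; first by case: s Es.
    by rewrite !item_edges_cat !verts_spine !last_spine_spine (item_edges_spine q2 q).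
  rewrite !item_edges_cat !verts_spine !last_spine_spine.
  by rewrite (item_edges_spine q1 q) (item_edges_spine q2 q).
have E u : cat_edges (spine q (rcons s v) ++ u) =
    cat_edges (spine q (rcons s v)) ++ item_edges v v u.
  case: s {Es} => [|a s] //=.
  by rewrite item_edges_cat verts_spine last_spine_spine last_rcons.
rewrite !E item_edges_cat verts_hang last_spine_hang.
rewrite (item_edges_starts _ v _ st) !mem_cat.
by rewrite -!orbA (orbC (e \in item_edges v v t)).
Qed.

(** All spine edges but the last lie among earlier vertices, so the only edge at [v] leads to its
    predecessor. *)
Lemma spine_last_edge q s v y : uniq (rcons s v) -> y != v ->
  [set v; y]%SET \in cat_edges (spine q (rcons s v)) -> exists s', s = rcons s' y.
Proof.
case/lastP: s => [|s w] //= us yv.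
have -> : cat_edges (spine q (rcons (rcons s w) v)) =
    cat_edges (spine q (rcons s w)) ++ [:: [set w; v]%SET].
  case: s {us} => [|a s] //=.
  rewrite /spine map_rcons -cats1 item_edges_cat /= -/(spine q _).
  by rewrite last_spine_spine last_rcons.
rewrite mem_cat => /orP[|].
  move: us; rewrite rcons_uniq; case: s => [|a s] /= /andP[vs _] //.
  move=> /item_edges_sub/(_ v); rewrite !inE eqxx verts_spine => /(_ isT).
  rewrite orbA orbb -in_cons => vs'; move: vs; rewrite inE.
  by move: vs'; rewrite inE => ->.
rewrite inE => /eqP E; exists s; congr rcons.
have : y \in [set w; v]%SET by rewrite -E !inE eqxx orbT.
by rewrite !inE (negbTE yv) orbF => /eqP.
Qed.

(** After the first item, [v] is neither the previous vertex nor the last spine vertex, so no later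
    edge contains it. *)
Lemma item_first_edge v y t : starts_spine t -> v \notin verts t -> y != v ->
  [set v; y]%SET \in item_edges v v t -> ohead (verts t) = Some y.
Proof.
case: t => [|i t] //= /negbTE->; rewrite !inE negb_or => /andP[vi vt] yv.
move=> /orP[/eqP E|].
  have : y \in [set v; i.1]%SET by rewrite -E !inE eqxx orbT.
  by rewrite !inE (negbTE yv) /= => /eqP->.
move=> /item_edges_sub/(_ v); rewrite !inE eqxx => /(_ isT).
by rewrite (negbTE vi) (negbTE vt).
Qed.

End caterpillars.

(** * Hanging witness paths greedily on a path inside a tree *)

Section greedy.
Variables (R : realType) (V : finType) (E : {set {set V}}) (A : {set V}).
Hypothesis acyc : forall c : seq V, (2 < size c)%N -> ~~ ucycleb (induced_adj E A) c.

Lemma adj_sym : symmetric (adj E).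
Proof. by move=> u v; rewrite /adj /= eq_sym finset.setUC. Qed.

Lemma induced_adj_sym : symmetric (induced_adj E A).
Proof. by move=> u v; rewrite /induced_adj /= adj_sym andbCA. Qed.

Lemma induced_path v s : all [in A] (v :: s) -> path (adj E) v s ->
  path (induced_adj E A) v s.
Proof.
elim: s v => [|w s IH] v //= /and3P[vA wA sA] /andP[vw ws].
by rewrite /induced_adj /= vA wA vw IH //= wA.
Qed.

Definition embedded (t : seq (item V)) : Prop :=
  [/\ uniq (verts t), {subset verts t <= A} & {subset cat_edges t <= E}].

Lemma cat_edge_verts (t : seq (item V)) u v : [set u; v]%SET \in cat_edges t ->
  u \in verts t /\ v \in verts t.
Proof.
case: t => // i t /= /item_edges_sub sub.
have mem y : y \in [set u; v]%SET -> y \in i.1 :: verts t.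
  by move=> /sub; rewrite !inE orbA orbb.
by split; apply: mem; rewrite !inE eqxx ?orbT.
Qed.

Lemma embedded_adj t : embedded t -> subrel (cat_adj t) (induced_adj E A).
Proof.
move=> [ut tA tE] u v uv; have [ut' vt'] := cat_edge_verts uv.
rewrite /induced_adj /adj /= (tA _ ut') (tA _ vt') (tE _ uv) andbT /=.
have [_ /(_ _ uv)] := cat_edges_uniq ut.
by rewrite cards2; case: eqP.
Qed.

Lemma embedded_path t u v : embedded t -> u \in verts t -> v \in verts t ->
  exists p, [/\ path (cat_adj t) u p, path (induced_adj E A) u p,
                uniq (u :: p) & last u p = v].
Proof.
move=> et ut vt; have /connectP[p pp ->] := cat_connect ut vt.
case/shortenP: pp => q pq uq _; exists q; split => //.
exact: sub_path (embedded_adj et) _ _ pq.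
Qed.

(** The tree joins [u] to [v] by a path inside [A], which by uniqueness of paths is the single step.
    An embedded caterpillar is therefore an induced subgraph. *)
Lemma embedded_induced t u v : embedded t -> u \in verts t -> v \in verts t ->
  adj E u v -> [set u; v]%SET \in cat_edges t.
Proof.
move=> et ut vt uv; have [p [tp pp up lp]] := embedded_path et ut vt.
have [_ tA _] := et.
suff Ep : p = [:: v] by move: tp; rewrite Ep /= andbT.
apply: (acyclic_path_unique induced_adj_sym acyc (x := u)) => //=.
- by rewrite /induced_adj /= (tA _ ut) (tA _ vt) uv.
- by rewrite andbT inE; case/andP: uv.
Qed.

(** If [z] met the tree again at [y], its piece up to [y] would be the tree path from [v] to [y], so
    its first step would be a tree edge. *)
Lemma embedded_disjoint t v z : embedded t -> v \in verts t ->
  path (induced_adj E A) v z -> uniq (v :: z) ->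
  (forall y, ohead z = Some y -> [set v; y]%SET \notin cat_edges t) ->
  ~~ has [in verts t] z.
Proof.
move=> et vt pz uz hz; apply/hasPn => y yz; apply/negP => yt.
have [p [tp pp up lp]] := embedded_path et vt yt.
case/splitPr: yz pz uz hz => z1 z2 pz uz hz.
have Ep : p = rcons z1 y.
  apply: (acyclic_path_unique induced_adj_sym acyc (x := v)) => //.
  - by move: pz; rewrite -cat_rcons cat_path => /andP[].
  - by move: uz; rewrite -cat_rcons -cat_cons cat_uniq => /andP[].
  - by rewrite lp last_rcons.
have : ohead (z1 ++ y :: z2) = ohead p by rewrite Ep; case: (z1).
case: p Ep tp {pp up lp} => [|w p Ep /= /andP[vw _] Ez]; first by case: (z1).
by move: (hz w Ez); rewrite -[_ \in _]/(cat_adj t v w) vw.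
Qed.

Lemma common_prefix (s z : seq V) : exists c s' z',
  [/\ s = c ++ s', z = c ++ z' & forall y, ohead z' = Some y -> ohead s' <> Some y].
Proof.
elim: s z => [|a s IH] [|b z].
- by exists [::], [::], [::].
- by exists [::], [::], (b :: z).
- by exists [::], (a :: s), [::].
have [<-|ab] := eqVneq a b.
  have [c [s' [z' [-> -> h]]]] := IH z.
  by exists (a :: c), s', z'.
exists [::], (a :: s), (b :: z); split=> // y [<-] [E']; by rewrite E' eqxx in ab.
Qed.

Lemma path_sub_verts v z y : path (induced_adj E A) v z -> y \in z -> y \in A.
Proof.
elim: z v => [|w z IH] v //= /andP[/and3P[_ wA _] wz].
by rewrite inE => /orP[/eqP->//|]; exact: IH wz.
Qed.

Lemma hang_edges_sub v x z :
  path (induced_adj E A) v z -> {subset item_edges v x (hang z) <= E}.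
Proof.
elim: z v => [|w z IH] v //= /andP[/and3P[_ _ /andP[_ vw]] wz] e.
by rewrite inE => /orP[/eqP->//|]; exact: IH wz _.
Qed.

Lemma filter_hang (z : seq V) : [seq i <- hang z | ~~ hanging i] = [::].
Proof. by elim: z. Qed.

Lemma filter_spine q (z : seq V) : verts [seq i <- spine q z | ~~ hanging i] = z.
Proof. by elim: z => //= v z ->. Qed.

Variables (P : seq V) (Q : V -> seq V) (M : V -> R) (back : pred V).
Hypothesis P_uniq : uniq P.
Hypothesis P_sub : {subset P <= A}.
Hypothesis P_path : sorted (adj E) P.
Hypothesis Q_path : {in P, forall v, path (induced_adj E A) v (Q v)}.
Hypothesis Q_uniq : {in P, forall v, uniq (v :: Q v)}.
Hypothesis Q_weight : {in P, forall v, 1 <= \prod_(u <- v :: Q v) M u}.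
Hypothesis back_spec : forall s u v s', P = s ++ [:: u, v & s'] -> ~~ back v ->
  ohead (Q v) <> Some u.

Lemma embedded_spine q s s' : P = s ++ s' -> embedded (spine q s).
Proof.
move=> EP; split; rewrite ?verts_spine.
- by move: P_uniq; rewrite EP cat_uniq => /andP[].
- by move=> v vs; apply: P_sub; rewrite EP mem_cat vs.
- move: P_path; rewrite EP; case: s {EP} => [|a s] //=.
  rewrite cat_path => /andP[+ _].
  elim: s a => [|b s IH] a //= /andP[/andP[_ ab] bs] e.
  by rewrite inE => /orP[/eqP->//|]; exact: IH.
Qed.

(** Recursion along [P], with prefix [s] already passed. A vertex in [back] becomes an unselected
    spine item. Otherwise its witness splits as [c ++ z] where [c] follows [P]: the block [v :: c]
    is selected, [z] is hung at its end, and the recursion resumes after the block, so the witnesses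
    used are disjoint. Every vertex outside [back] gets selected. The prefix is kept in the embedded
    tree so that new branches avoid it too. *)
Lemma greedy_caterpillar s' s : P = s ++ s' -> exists t : seq (item V),
  [/\ starts_spine t, verts [seq i <- t | ~~ hanging i] = s',
      embedded (spine false s ++ t),
      [/\ (count (predC back) s' <= count (fun i => ~~ hanging i && selected i) t)%N &
      all (fun i => hanging i ==> selected i) t] &
      1 <= \prod_(i <- t | selected i) M i.1].
Proof.
elim: (size s').+1 {-2}s' (ltnSn (size s')) s => // m IH {}s' ss' s EP.
case: s' ss' EP => [|v s'] ss' EP.
  exists [::]; split=> //; last by rewrite big_nil.
  by rewrite cats0; exact: embedded_spine EP.
have vP : v \in P by rewrite EP mem_cat inE eqxx orbT.
have [bv|bv] := boolP (back v).
  have EP' : P = rcons s v ++ s' by rewrite cat_rcons.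
  have [t [st vt et [ct at_] Mt]] := IH s' ss' _ EP'.
  exists ((v, (false, false)) :: t); split => //=.
  - by rewrite vt.
  - by move: et; rewrite /spine map_rcons cat_rcons.
  - by rewrite bv.
  - by rewrite big_cons.
have [c [s1 [z [Es' EQ hz]]]] := common_prefix s' (Q v).
have EP' : P = (s ++ v :: c) ++ s1 by rewrite EP Es' -catA.
have ss1 : (size s1 < m)%N by move: ss'; rewrite Es' /= size_cat; lia.
have [t [st vt et [ct at_] Mt]] := IH s1 ss1 _ EP'.
pose w := last v c.
pose s0 := s ++ belast v c.
have Es0 : s0 ++ [:: w] = s ++ v :: c by rewrite -catA cats1 -lastI.
have wz : path (induced_adj E A) w z /\ uniq (w :: z).
  have := Q_path vP; have := Q_uniq vP; rewrite EQ cat_path => + /andP[_ ->].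
  by rewrite -cat_cons lastI cat_rcons cat_uniq => /and3P[_ _ ->].
have [pz uz] := wz.
rewrite -Es0 cats1 in et.
have wv : w \in verts (spine false (rcons s0 w) ++ t).
  by rewrite /verts map_cat mem_cat -/(verts _) verts_spine mem_rcons inE eqxx.
have ut : uniq (rcons s0 w ++ verts t).
  by have [+ _ _] := et; rewrite /verts map_cat -!/(verts _) verts_spine.
(* It suffices that [z] does not leave [w] by a tree edge. The tree neighbours of [w] are its
   predecessor on [P], excluded by [back_spec] if [c] is empty and by simplicity of the witness
   otherwise, and its successor, excluded by maximality of the common prefix. *)
have dz : ~~ has [in verts (spine false (rcons s0 w) ++ t)] z.
  apply: (embedded_disjoint et wv pz uz) => y Ez.
  have yw : y != w.
    by move: uz; case: (z) Ez => //= ? ? [->]; rewrite inE negb_or eq_sym => /andP[/andP[]].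
  have -> : cat_edges (spine false (rcons s0 w) ++ t) =
      cat_edges (spine false (rcons s0 w)) ++ item_edges w w t.
    case: (s0) => [|a s2] //=.
    by rewrite item_edges_cat verts_spine last_spine_spine last_rcons.
  rewrite mem_cat negb_or; apply/andP; split; apply/negP.
    move: ut; rewrite cat_uniq => /and3P[us0 _ _].
    move=> /(spine_last_edge us0 yw)[s2 Es2].
    have [c0|c0] := eqVneq c [::].
      move: Es2; rewrite /s0 c0 cats0 => Es2.
      apply: (back_spec (s := s2) (u := y) (v := v) (s' := s') _ bv).
        by rewrite EP Es2 cat_rcons.
      by rewrite EQ c0.
    have yc : y \in belast v c.
      have : last v s0 = y by rewrite Es2 last_rcons.
      by rewrite last_cat; case: (c) c0 => //= a c' _ <-; exact: mem_last.
    have := Q_uniq vP; rewrite EQ -cat_cons lastI cat_rcons cat_uniq.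
    move=> /and3P[_ /hasPn/(_ y) + _]; rewrite /= yc => yz.
    have : y \in w :: z by case: (z) Ez => //= ? ? [->]; rewrite !inE eqxx orbT.
    by move=> /yz.
  move: ut; rewrite cat_uniq => /and3P[_ /hasPn nt _].
  have wt : w \notin verts t.
    by apply/negP => /nt /negP[]; rewrite /= mem_rcons inE eqxx.
  move=> /(item_first_edge st wt yw) ty; apply: (hz y Ez).
  by move: ty; rewrite -vt; case: (t) st => //= i t' ->.
have Et := cat_edges_insert false false true z Es0 st.
exists (spine true (v :: c) ++ hang z ++ t); split => //.
- by rewrite !filter_cat /verts !map_cat -!/(verts _) vt Es' filter_hang cat0s filter_spine.
- have [_ tA tE] := et; split.
  + rewrite /verts !map_cat -!/(verts _) !verts_spine verts_hang catA -Es0 cats1.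
    move: dz ut; rewrite /verts map_cat -!/(verts _) !verts_spine => dz ut.
    rewrite uniq_catCA cat_uniq ut; move: uz => /= /andP[_ ->] /=.
    by rewrite andbT has_sym.
  + move=> y; rewrite /verts !map_cat -!/(verts _) !verts_spine verts_hang catA -Es0 cats1.
    rewrite !mem_cat => /or3P[ys|yz|yt].
    * by apply: tA; rewrite /verts map_cat -/(verts _) verts_spine mem_cat ys.
    * exact: path_sub_verts pz yz.
    * by apply: tA; rewrite /verts map_cat mem_cat yt orbT.
  + move=> e; rewrite Et mem_cat => /orP[/tE//|].
    exact: (hang_edges_sub pz).
- split.
    rewrite /= !count_cat bv Es' count_cat /=.
    have -> : count (fun i => ~~ hanging i && selected i) (spine true c) = size c.
      by rewrite /spine count_map (eq_count (a2 := predT)) // count_predT.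
    rewrite leq_add2l leq_add ?count_size //.
    exact: leq_trans ct (leq_addl _ _).
  rewrite /= !all_cat at_ andbT; apply/andP; split.
    by rewrite all_map; apply/allP.
  by rewrite all_map; apply/allP.
- rewrite !big_cat /=.
  have -> : \prod_(i <- spine true (v :: c) | selected i) M i.1 = \prod_(u <- v :: c) M u.
    by rewrite /spine big_map.
  have -> : \prod_(i <- hang z | selected i) M i.1 = \prod_(u <- z) M u.
    by rewrite /hang big_map.
  rewrite mulrA -[leLHS]mulr1; apply: ler_pM => //.
  by have := Q_weight vP; rewrite EQ -cat_cons big_cat.
Qed.

End greedy.

(** * From a path without block vertices to a caterpillar *)

Lemma index_consecutive (T : eqType) (P s s' : seq T) u v :
  uniq P -> P = s ++ [:: u, v & s'] -> index v P = (index u P).+1.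
Proof.
move=> uP EP.
have iu : index u P = size s.
  have -> : u = nth u P (size s) by rewrite EP nth_cat ltnn subnn.
  by rewrite index_uniq // EP size_cat /=; lia.
have -> : v = nth u P (size s).+1 by rewrite EP nth_cat ltnNge leqnSn /= subSnn.
by rewrite index_uniq ?iu // EP size_cat /=; lia.
Qed.

Lemma count_selected (V : finType) (t : seq (item V)) :
  all (fun i => hanging i ==> selected i) t ->
  count (@selected V) t =
  (count (@hanging V) t + count (fun i => ~~ hanging i && selected i) t)%N.
Proof.
elim: t => //= i t IH /andP[hi /IH->].
by case: hanging hi => /=; [move=> ->|]; lia.
Qed.

(** The greedy construction is run on the path or on its reversal, whichever has at least half of
    its vertices outside [back]. All hanging items are selected, so at least half of all items
    are. *)
Lemma nonblock_caterpillar (R : realType) (V : finType) (d eps beta r l : R)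
    (E : {set {set V}}) (J : {set V} -> R) (p : V * seq V) :
  0 <= r -> simple_paths E r l p ->
  (forall u, u \in p.1 :: p.2 -> ~ block_vertex d eps beta E J r u) ->
  exists t : seq (item V),
    [/\ uniq (verts t), {subset cat_edges t <= E},
        {in verts t &, forall u v, adj E u v -> [set u; v]%SET \in cat_edges t},
        [/\ (0 < size t)%N, l <= (size t)%:R &
          (size t <= (count (@selected V) t).*2)%N] &
        1 <= \prod_(i <- t | selected i) vertex_weight d eps beta E J i.1].
Proof.
case: p => x s r0 [/= /andP[xs us] [A0 Aconn acyc] ls] nb.
set A := nbhd E r x s in A0 Aconn acyc.
have sA v z : v \in x :: s -> is_path E v z -> (size z)%:R <= r -> all [in A] (v :: z).
  move=> vs /andP[vz uz] zr; apply/allP => y.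
  rewrite inE => /predU1P[->|yz].
    by rewrite /A inE; apply/asboolP; exists v, [::].
  case/splitPr: yz vz uz zr => z1 z2 vz uz zr.
  rewrite /A inE; apply/asboolP; exists v, (rcons z1 y).
  rewrite last_rcons; split => //.
    move: vz uz; rewrite -cat_rcons cat_path => /andP[h _].
    by rewrite -cat_cons cat_uniq => /and3P[h2 _ _]; rewrite /is_path h h2.
  by apply: le_trans zr; rewrite ler_nat size_rcons size_cat /=; lia.
have /choice[Q HQ] : forall v, exists z, v \in x :: s ->
    [/\ path (induced_adj E A) v z, uniq (v :: z) &
        1 <= \prod_(u <- v :: z) vertex_weight d eps beta E J u].
  move=> v; have [vs|_] := boolP (v \in x :: s); last by exists [::].
  have /existsNP[z /not_implyP[pz /not_implyP[zr zw]]] := nb v vs.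
  exists z => _; case/andP: (pz) => vz uz; split => //.
    by apply: induced_path => //; exact: sA.
  by rewrite leNgt; apply/negP.
(* The witness of [v] first steps to the predecessor of [v]. The order is a parameter because [P]
   and [rev P] are both tried. *)
pose back P v := `[< exists s u s', P = s ++ [:: u, v & s'] /\ ohead (Q v) = Some u >].
have key P : uniq P -> P =i x :: s -> sorted (adj E) P -> (l <= (size P)%:R) ->
    (0 < size P)%N -> (size P <= (count (predC (back P)) P).*2)%N ->
    exists t : seq (item V),
    [/\ uniq (verts t), {subset cat_edges t <= E},
        {in verts t &, forall u v, adj E u v -> [set u; v]%SET \in cat_edges t},
        [/\ (0 < size t)%N, l <= (size t)%:R &
          (size t <= (count (@selected V) t).*2)%N] &
        1 <= \prod_(i <- t | selected i) vertex_weight d eps beta E J i.1].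
  move=> uP Px sP lP P0 bP.
  have PA : {subset P <= A}.
    move=> v; rewrite Px => vx.
    by have := sA v [::] vx isT r0 => /andP[].
  have [||||t [_ vt et [ct ht] Mt]] := @greedy_caterpillar R V E A acyc P Q
      (vertex_weight d eps beta E J) (back P) uP PA sP _ _ _ _ P [::] erefl.
  - by move=> v; rewrite Px => /HQ[].
  - by move=> v; rewrite Px => /HQ[].
  - by move=> v; rewrite Px => /HQ[].
  - by move=> s1 u v s2 EP /asboolP nbv hu; apply: nbv; exists s1, u, s2.
  have szP : count (predC (@hanging V)) t = size P.
    by rewrite -size_filter -vt /verts size_map.
  have szt := count_predC (@hanging V) t.
  have cs := count_selected ht.
  have [utt tA tE] := et; exists t; split => //.
    by move=> u v ut vt'; exact: (embedded_induced acyc et).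
  split; first by lia.
  - by apply: le_trans lP _; rewrite ler_nat; lia.
  - rewrite -szt cs szP doubleD leq_add //; first by rewrite -addnn leq_addr.
    by rewrite (leq_trans bP) // leq_double.
set P := x :: s in us nb sA HQ key *.
have lP : l <= (size P)%:R by apply: le_trans ls _; rewrite ler_nat.
(* A vertex in [back] for both orders would have the first vertex of its witness both just before
   and just after it on [P]. *)
have cP : (size P <= count (predC (back P)) P + count (predC (back (rev P))) P)%N.
  rewrite -count_predUI.
  apply: leq_trans (leq_addr _ _); rewrite -[leqLHS]count_predT; apply: sub_count => v _ /=.
  rewrite -negb_and; apply/negP => /andP[/asboolP[s1 [u [s2 [E1 Qu]]]]].
  move=> /asboolP[s3 [u' [s4 [E2 Qu']]]].
  move: E2 Qu' ; rewrite Qu => + [Eu]; rewrite -{}Eu => E2.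
  have E3 : P = rev s4 ++ [:: v, u & rev s3].
    by rewrite -[P]revK E2 rev_cat !rev_cons -!cats1 -!catA.
  have := index_consecutive us E1; have := index_consecutive us E3; lia.
have [c1|c1] := leqP (size P) (count (predC (back P)) P).*2.
  exact: (key P).
apply: (key (rev P)).
- by rewrite rev_uniq.
- exact: mem_rev.
- by rewrite rev_sorted (eq_sorted (e' := adj E)) // => u v; exact: adj_sym.
- by rewrite size_rev.
- by rewrite size_rev.
- have dbl a b m : (a.*2 < m -> m <= a + b -> m <= b.*2)%N by lia.
  by rewrite size_rev count_rev; exact: dbl c1 cP.
Qed.

(** * Expectations over finite configurations of edges and influence levels *)

Section configurations.
Variables (R : realType) (n K : nat) (p : R) (q g : 'I_K -> R).
Hypotheses (p01 : 0 <= p <= 1) (q_ge0 : forall k, 0 <= q k).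
Hypotheses (q_sum1 : \sum_k q k = 1) (g_ge0 : forall k, 0 <= g k).

(* The first component tells whether the pair is an edge, the second one is the
   discretised influence level of its coupling. *)
Definition config : finType := {ffun vpair n -> bool * 'I_K}.
Implicit Types (w : config) (t : seq (item 'I_n)).

Definition config_prob w : R := \prod_e (bernoulli_pmf p (w e).1 * q (w e).2).

Definition config_agg w (v : 'I_n) : R :=
  \sum_(e : vpair n | (v \in val e) && (w e).1) g (w e).2.

(** The caterpillar must be an induced subgraph. With no further edge inside it, only tree edges can
    count towards the aggregate influence of two of its vertices. *)
Definition config_fits w t : bool :=
  [forall e : vpair n, ((val e \in cat_edges t) ==> (w e).1) &&
    ((w e).1 && (val e \subset verts t) ==> (val e \in cat_edges t))].

Lemma config_prob_ge0 w : 0 <= config_prob w.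
Proof. by apply: prodr_ge0 => e _; rewrite mulr_ge0 ?bernoulli_pmf_ge0. Qed.

Lemma config_expectation_prod (f : vpair n -> bool * 'I_K -> R) :
  \sum_w config_prob w * \prod_e f e (w e) =
  \prod_e (p * (\sum_k q k * f e (true, k)) + (1 - p) * \sum_k q k * f e (false, k)).
Proof.
transitivity (\sum_(w : config) \prod_e (bernoulli_pmf p (w e).1 * q (w e).2 * f e (w e))).
  by apply: eq_bigr => w _; rewrite -big_split.
rewrite -(bigA_distr_bigA (fun e xk => bernoulli_pmf p xk.1 * q xk.2 * f e xk)).
apply: eq_bigr => e _.
transitivity (\sum_x \sum_k bernoulli_pmf p x * q k * f e (x, k)).
  by rewrite pair_bigA /=; apply: eq_bigr => -[x k] _.
rewrite big_bool /=; congr (_ + _); rewrite big_distrr /=.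
  by apply: eq_bigr => k _; rewrite mulrA.
by apply: eq_bigr => k _; rewrite mulrA.
Qed.

Variables (lam B D : R).
Hypotheses (lam_ge0 : 0 <= lam).
(** The exponential moment contributed by one pair to one of its ends; [D] bounds its [n]-th power
    because a vertex lies in fewer than [n] pairs. The moment in [B_bound] is for a tree edge
    counted at both ends, hence its factor 2. *)
Let D0 : R := 1 - p + p * \sum_k q k * expR (lam * g k).
Hypothesis B_bound : \sum_k q k * expR (2 * lam * g k) <= B.
Hypothesis D_bound : D0 ^+ n <= D.

Lemma crossing_factor_ge1 : 1 <= D0.
Proof.
suff : 1 <= \sum_k q k * expR (lam * g k) by move: p01; rewrite /D0; nra.
rewrite -q_sum1; apply: ler_sum => k _; rewrite ler_peMr //.
by rewrite -expR0 ler_expR mulr_ge0.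
Qed.

(** A tree edge is present and counts at most twice. A pair with exactly one end in [S] counts once
    if present. Any other pair either misses [S] or is absent because the caterpillar is induced. *)
Let factor t (S : {set 'I_n}) (e : vpair n) (xk : bool * 'I_K) : R :=
  if val e \in cat_edges t then xk.1%:R * expR (2 * lam * g xk.2)
  else if #|val e :&: S|%SET == 1%N then (if xk.1 then expR (lam * g xk.2) else 1)
  else 1.

Lemma factor_bound w t (S : {set 'I_n}) : {subset S <= verts t} ->
  (config_fits w t)%:R * expR (lam * \sum_(v in S) config_agg w v) <=
  \prod_e factor t S e (w e).
Proof.
move=> St; have fac0 e xk : 0 <= factor t S e xk.
  by rewrite /factor; do !case: ifP => _; rewrite ?mulr_ge0 ?expR_ge0.
have [/forallP ft|_] := boolP (config_fits w t); last first.
  by rewrite mul0r prodr_ge0.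
rewrite mul1r.
have -> : \sum_(v in S) config_agg w v =
    \sum_e (if (w e).1 then #|val e :&: S|%SET%:R * g (w e).2 else 0).
  rewrite /config_agg (exchange_big_dep xpredT) //=.
  apply: eq_bigr => e _; case: ifP => we.
    rewrite -sum1_card natr_sum mulr_suml.
    apply: eq_big => [v|v _]; last by rewrite mul1r.
    by rewrite inE andbT andbC.
  by apply: big_pred0 => v; rewrite !andbF.
rewrite big_distrr /= expR_sum; apply: ler_prod => e _.
apply/andP; split; first exact: expR_ge0.
have e2 : (#|val e :&: S|%SET <= 2)%N.
  by apply: leq_trans (subset_leq_card (finset.subsetIl _ _)) _; rewrite (eqP (valP e)).
have /andP[/implyP fe /implyP fe'] := ft e.
rewrite /factor; have [et|et] := boolP (val e \in cat_edges t).
  rewrite fe // mul1r ler_expR mulrA ler_wpM2r // mulrC ler_wpM2r //.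
  by rewrite ler_nat.
have [c1|/negbTE c1] := boolP (#|val e :&: S|%SET == 1%N).
  by rewrite (eqP c1) mul1r; case: ifP => _; rewrite // mulr0 expR0.
case: ifP => we; last by rewrite mulr0 expR0.
rewrite we /= in fe'.
suff -> : #|val e :&: S|%SET = 0%N by rewrite mul0r mulr0 expR0.
have : #|val e :&: S|%SET != 2%N; last by move: c1 e2; case: #|_| => [|[|[|]]].
apply: contra et => /eqP e2'; apply: fe'.
have /eqP <- : (val e :&: S == val e)%SET.
  by rewrite eqEcard finset.subsetIl e2' (eqP (valP e)).
by apply/fintype.subsetP => v; rewrite inE => /andP[_ /St].
Qed.

Lemma card_crossing (S : {set 'I_n}) :
  (#|[pred e : vpair n | #|val e :&: S|%SET == 1%N]| <= #|S| * n)%N.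
Proof.
have <- : #|finset.setX S [set: 'I_n]%SET| = (#|S| * n)%N.
  by rewrite cardsX cardsT card_ord.
rewrite -(card_imset _ val_inj).
apply: leq_trans (leq_imset_card (fun vw : 'I_n * 'I_n => [set vw.1; vw.2]%SET) _).
apply/subset_leq_card/fintype.subsetP => E /imsetP[e]; rewrite inE => e1 ->.
have /cards2P[u [v [uv Ee]]] := valP e.
have /set0Pn[x] : (val e :&: S)%SET != finset.set0 by rewrite -card_gt0 (eqP e1).
rewrite !inE Ee !inE => /andP[/orP[]/eqP-> xS]; apply/imsetP.
  by exists (u, v); rewrite // !inE xS.
by exists (v, u); rewrite /= ?(finset.setUC [set v]%SET) // !inE xS.
Qed.

Lemma card_cat_edges t : uniq (verts t) ->
  #|[pred e : vpair n | val e \in cat_edges t]| = (size t).-1.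
Proof.
move=> ut; have [ue e2] := cat_edges_uniq ut.
rewrite -size_cat_edges -(card_uniqP ue) -(card_imset _ val_inj).
apply: eq_card => E; apply/imsetP/idP => [[e + ->]|Et]; first by rewrite inE.
by exists (Sub E (introT eqP (e2 _ Et))); rewrite ?SubK // inE.
Qed.

(** The pairs are independent: each tree edge costs at most [p * B], and each of the at most
    [#|S| * n] crossing pairs costs [D0]. *)
Lemma fits_expectation t (S : {set 'I_n}) : uniq (verts t) -> {subset S <= verts t} ->
  \sum_w config_prob w * ((config_fits w t)%:R * expR (lam * \sum_(v in S) config_agg w v))
  <= (p * B) ^+ (size t).-1 * D ^+ #|S|.
Proof.
move=> ut St.
apply: (@le_trans _ _ (\sum_w config_prob w * \prod_e factor t S e (w e))).
  by apply: ler_sum => w _; rewrite ler_wpM2l ?config_prob_ge0 ?factor_bound.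
rewrite config_expectation_prod.
have B0 : 0 <= B by apply: le_trans B_bound; apply: sumr_ge0 => k _; rewrite mulr_ge0 ?expR_ge0.
have [p0 p1] := andP p01.
have D1 := crossing_factor_ge1.
pose c (e : vpair n) := #|val e :&: S|%SET == 1%N.
(* Crossing tree edges are charged the factor [D0 >= 1] as well, so that the product separates. *)
apply: (@le_trans _ _ (\prod_e ((if val e \in cat_edges t then p * B else 1) *
   (if c e then D0 else 1)))).
  apply: ler_prod => e _; apply/andP; split.
    by rewrite addr_ge0 // mulr_ge0 ?subr_ge0 //; apply: sumr_ge0 => k _;
      rewrite mulr_ge0 // /factor; do !case: ifP => _; rewrite ?mulr_ge0 ?expR_ge0.
  rewrite /factor -/(c e); case: ifP => et /=.
    under [X in _ + _ * X]eq_bigr do rewrite mul0r mulr0.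
    rewrite big1_eq mulr0 addr0; under eq_bigr do rewrite mul1r.
    apply: (@le_trans _ _ (p * B)); first by rewrite ler_wpM2l.
    by rewrite ler_peMr ?mulr_ge0 //; case: ifP.
  rewrite mul1r; case: ifP => _ /=.
    by under [X in _ + _ * X]eq_bigr do rewrite mulr1; rewrite q_sum1 mulr1 addrC.
  by under eq_bigr do rewrite mulr1; rewrite q_sum1 !mulr1 addrC subrK.
rewrite big_split /= -!big_mkcond /= !prodr_const.
rewrite -(card_cat_edges ut).
apply: ler_pM; rewrite ?exprn_ge0 ?mulr_ge0 ?(le_trans _ D1) //.
apply: (@le_trans _ _ (D0 ^+ (#|S| * n))).
  by rewrite ler_weXn2l // card_crossing.
rewrite mulnC exprM lerXn2r // nnegrE ?exprn_ge0 ?(le_trans _ D_bound) // ?exprn_ge0 ?(le_trans _ D1) //.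
Qed.

Variables (al ga : R).
Hypotheses (al_ge0 : 0 <= al) (ga_ge0 : 0 <= ga).

(** The product over [L] is expanded one vertex at a time: the term [al] drops the vertex, the
    exponential term moves it into [S] at the cost of one more factor [D]. *)
Lemma fits_weighted_expectation t (L : seq 'I_n) (S : {set 'I_n}) :
  uniq (verts t) -> uniq L -> {subset L <= verts t} -> {subset S <= verts t} ->
  ~~ has [in S] L ->
  \sum_w config_prob w * ((config_fits w t)%:R * expR (lam * \sum_(v in S) config_agg w v) *
     \prod_(v <- L) (al + ga * expR (lam * config_agg w v)))
  <= (p * B) ^+ (size t).-1 * D ^+ #|S| * (al + ga * D) ^+ size L.
Proof.
move=> ut; elim: L S => [|v L IH] S /=.
  move=> _ _ St _; rewrite mulr1; apply: le_trans (fits_expectation ut St).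
  by apply: ler_sum => w _; rewrite big_nil mulr1.
move=> /andP[vL uL] Lt St /norP[vS LS].
have Lt' : {subset L <= verts t} by move=> u uL'; apply: Lt; rewrite inE uL' orbT.
have vt : v \in verts t by apply: Lt; rewrite inE eqxx.
have St' : {subset (v |: S)%SET <= verts t}.
  by move=> u; rewrite !inE => /orP[/eqP->//|/St].
have LS' : ~~ has [in (v |: S)%SET] L.
  apply/hasPn => u uL'; rewrite !inE negb_or (hasPn LS u uL') andbT.
  by apply: contra vL => /eqP <-.
have IH1 := IH S uL Lt' St LS; have IH2 := IH (v |: S)%SET uL Lt' St' LS'.
rewrite exprS [X in _ <= X](_ : _ = al * ((p * B) ^+ (size t).-1 * D ^+ #|S| * (al + ga * D) ^+ size L)
  + ga * ((p * B) ^+ (size t).-1 * D ^+ #|(v |: S)%SET| * (al + ga * D) ^+ size L)); last first.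
  by rewrite cardsU1 vS exprS; ring.
apply: le_trans (lerD (ler_wpM2l al_ge0 IH1) (ler_wpM2l ga_ge0 IH2)).
rewrite !big_distrr -big_split /= le_eqVlt; apply/orP; left; apply/eqP.
apply: eq_bigr => w _; rewrite big_cons big_setU1 //= mulrDr expRD; ring.
Qed.

(** Each factor will majorise the [m]-th power of a vertex weight. The sum is then at least 1
    whenever the event fails, and its expectation bounds the failure probability. *)
Definition caterpillar_sum (l : R) w : R :=
  \sum_(N < n.+1 | (0 < N)%N && (l <= N%:R))
    \sum_(t : N.-tuple (item 'I_n) | uniq (verts t) && (N <= (count (@selected _) t).*2)%N)
      (config_fits w t)%:R *
      \prod_(i <- t | selected i) (al + ga * expR (lam * config_agg w i.1)).

(** At least N/2 selected vertices, each costing [u ^+ 2], give [u ^+ N]; the sum over admissible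
    tuples is enlarged to all (4n)^N of them. *)
Lemma caterpillar_sum_expectation (l u : R) : 0 <= u -> u <= 1 -> al + ga * D <= u ^+ 2 ->
  \sum_w config_prob w * caterpillar_sum l w <=
  \sum_(N < n.+1 | (0 < N)%N && (l <= N%:R)) (4 * n%:R * u) ^+ N * (p * B) ^+ N.-1.
Proof.
move=> u0 u1 rho.
have B0 : 0 <= B by apply: le_trans B_bound; apply: sumr_ge0 => k _; rewrite mulr_ge0 ?expR_ge0.
have [p0 p1] := andP p01.
have D0_ge0 : 0 <= D.
  by apply: le_trans D_bound; rewrite exprn_ge0 // (le_trans _ crossing_factor_ge1).
under eq_bigr do rewrite /caterpillar_sum big_distrr /=.
rewrite exchange_big /=; apply: ler_sum => N _.
under eq_bigr do rewrite big_distrr /=.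
rewrite exchange_big /=.
apply: (@le_trans _ _ (\sum_(t : N.-tuple (item 'I_n)) u ^+ N * (p * B) ^+ N.-1)); last first.
  rewrite sumr_const -[leLHS]mulr_natr.
  have -> : #|{: N.-tuple (item 'I_n)}| = ((n * 4) ^ N)%N.
    by rewrite card_tuple !card_prod card_bool card_ord.
  by rewrite natrX natrM !exprMn le_eqVlt; apply/orP; left; apply/eqP; ring.
rewrite [leRHS](bigID (fun t : N.-tuple (item 'I_n) =>
  uniq (verts t) && (N <= (count (@selected _) t).*2)%N)) /= -[leLHS]addr0.
apply: lerD; last by apply: sumr_ge0 => t _; rewrite mulr_ge0 ?exprn_ge0 ?mulr_ge0.
apply: ler_sum => t /andP[ut ct].
pose L := verts [seq i <- t | selected i].
have Lt : subseq L (verts t) by apply/map_subseq/filter_subseq.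
have := @fits_weighted_expectation t L finset.set0 ut (subseq_uniq Lt ut) (mem_subseq Lt).
rewrite cards0 size_tuple expr0 mulr1 => /(_ _ _) H.
apply: le_trans (le_trans (H _ _) _).
- apply: ler_sum => w _; rewrite big_set0 mulr0 expR0 mulr1.
  by rewrite /L /verts big_map big_filter.
- by move=> v; rewrite inE.
- by apply/hasPn => v; rewrite /= inE.
- rewrite mulrC ler_wpM2r ?exprn_ge0 ?mulr_ge0 //.
  apply: (@le_trans _ _ ((u ^+ 2) ^+ size L)).
    by rewrite lerXn2r // nnegrE ?exprn_ge0 // addr_ge0 // mulr_ge0.
  rewrite -exprM ler_wiXn2l // mul2n.
  by rewrite /L /verts size_map size_filter.
Qed.

End configurations.

(** * Exponential moments of the rounded influence of a Gaussian coupling *)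

Section gaussian.
Variable R : realType.
Implicit Types (t x y beta : R).
Local Notation mu := (@lebesgue_measure R).

(** Multiply [(1 - y) * expR y <= 1] by [1 + y]. *)
Lemma expR_le_quadratic y : 0 <= y -> expR y <= 1 + y + y ^+ 2 * expR y.
Proof.
move=> y0; have ey := expR_gt0 y.
have : (1 - y) * expR y <= 1.
  by rewrite -ler_pdivlMr // mul1r -expRN; exact: expR_ge1Dx.
have : 0 <= y * expR y by rewrite mulr_ge0 // ltW.
nra.
Qed.

Lemma expR_half_lt2 : expR (2^-1 : R) <= 2.
Proof.
have e0 := expR_gt0 (2^-1 : R).
have : (1 - 2^-1) * expR (2^-1 : R) <= 1.
  by rewrite -ler_pdivlMr // mul1r -expRN; exact: expR_ge1Dx.
lra.
Qed.

Lemma normal_pdf01E x : normal_pdf 0 1 x = normal_peak 1 * expR (- (x ^+ 2 / 2)).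
Proof.
by rewrite normal_pdfE ?oner_eq0 // /normal_fun subr0 expr1n mulNr.
Qed.

(** The Taylor remainder [y ^+ 2 * expR (t * y)] is at most [16 * expR (y ^+ 2 / 4)], which turns
    the standard density into that of variance 2, up to the ratio [Num.sqrt 2 <= 3 / 2] of the
    peaks; 24 is 16 times 3/2. *)
Lemma expR_normal_le t x : 0 <= t -> t <= 2^-1 ->
  expR (t * `|x|) * normal_pdf 0 1 x <=
  normal_pdf 0 1 x + t * (`|x| * normal_pdf 0 1 x) + 24 * t ^+ 2 * normal_pdf 0 (Num.sqrt 2) x.
Proof.
move=> t0 t2; have [y [y0 -> x2]] : exists y : R, [/\ 0 <= y, `|x| = y & x ^+ 2 = y ^+ 2].
  by exists `|x|; rewrite normr_ge0 real_normK ?num_real.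
have f0 := normal_pdf_ge0 0 1 x.
suff key : y ^+ 2 * expR (t * y) * normal_pdf 0 1 x <= 24 * normal_pdf 0 (Num.sqrt 2) x.
  have := expR_le_quadratic (mulr_ge0 t0 y0).
  have : t ^+ 2 * (y ^+ 2 * expR (t * y) * normal_pdf 0 1 x) <=
     t ^+ 2 * (24 * normal_pdf 0 (Num.sqrt 2) x) by rewrite ler_wpM2l ?sqr_ge0.
  move: f0; move: (normal_pdf _ _ _) (normal_pdf _ _ _) (expR _) => F f e f0 h1 h2.
  have : e * f <= (1 + t * y + (t * y) ^+ 2 * e) * f by rewrite ler_wpM2r.
  nra.
have s2 : Num.sqrt 2 != 0 :> R by rewrite gt_eqF // sqrtr_gt0.
rewrite normal_pdf01E normal_pdfE // /normal_fun subr0 sqr_sqrtr //.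
rewrite x2.
have -> : - y ^+ 2 / (2 *+ 2) = - (y ^+ 2 / 4) :> R by field.
have pk : normal_peak 1 = Num.sqrt 2 * normal_peak (Num.sqrt 2) :> R.
  rewrite /normal_peak expr1n mul1r sqr_sqrtr // -mulrnAr sqrtrM //.
  by rewrite invfM mulrA divff // mul1r.
rewrite pk.
have N0 := normal_peak_ge0 (Num.sqrt (2 : R)).
have e1 : y ^+ 2 <= 8 * expR (y ^+ 2 / 8).
  have := expR_ge1Dx (y ^+ 2 / 8); lra.
(* Here [t <= 1/2], and [(y - 2) ^+ 2 >= 0] gives [y / 2 <= 1/2 + y ^+ 2 / 8]. *)
have e2 : expR (t * y) <= 2 * expR (y ^+ 2 / 8).
  apply: (@le_trans _ _ (expR (2^-1 + y ^+ 2 / 8))).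
    have ty : t * y <= 2^-1 * y by rewrite ler_wpM2r.
    by rewrite ler_expR; have := sqr_ge0 (y - 2); lra.
  by rewrite expRD ler_wpM2r ?expR_ge0 // expR_half_lt2.
have e3 : expR (y ^+ 2 / 8) * expR (y ^+ 2 / 8) * expR (- (y ^+ 2 / 2)) = expR (- (y ^+ 2 / 4)).
  by rewrite -!expRD; congr expR; field.
have sq : Num.sqrt 2 <= 3 / 2 :> R.
  rewrite -(@ler_pXn2r _ 2) ?nnegrE // sqr_sqrtr //; lra.
apply: (@le_trans _ _ ((8 * expR (y ^+ 2 / 8)) * (2 * expR (y ^+ 2 / 8)) *
   (Num.sqrt 2 * normal_peak (Num.sqrt 2) * expR (- (y ^+ 2 / 2))))).
  rewrite ler_wpM2r ?mulr_ge0 ?expR_ge0 //.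
  by rewrite ler_pM ?sqr_ge0 ?expR_ge0.
have -> : (8 * expR (y ^+ 2 / 8)) * (2 * expR (y ^+ 2 / 8)) *
   (Num.sqrt 2 * normal_peak (Num.sqrt 2) * expR (- (y ^+ 2 / 2))) =
   16 * Num.sqrt 2 * normal_peak (Num.sqrt 2) * expR (- (y ^+ 2 / 4)).
  by rewrite -e3; ring.
rewrite mulrA ler_wpM2r ?expR_ge0 // ler_wpM2r //; lra.
Qed.

Lemma continuous_gauss : continuous (fun x : R => expR (- (x ^+ 2 / 2))).
Proof.
move=> x; apply: (@continuous_comp _ _ _ (fun x : R => - (x ^+ 2 / 2)) expR).
  apply: cvgN; apply: cvgM; last exact: cvg_cst.
  exact: exprn_continuous.
exact: continuous_expR.
Qed.

(** By symmetry this is twice an integral over the half-line, where minus the density is an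
    antiderivative. The value is the square root of 2/pi. *)
Lemma integral_norm_normal :
  (\int[mu]_x (`|x| * normal_pdf 0 1 x)%:E)%E = (2 * normal_peak (1 : R))%:E.
Proof.
have pdfN x : normal_pdf 0 1 (- x) = normal_pdf 0 1 x by rewrite !normal_pdf01E sqrrN.
rewrite ge0_symfun_integralT /=; last first.
- by move=> x /=; rewrite normrN pdfN.
- move=> x; apply: cvgM; first exact: norm_continuous.
  by apply: continuous_normal_pdf; rewrite oner_eq0.
- by move=> x; rewrite mulr_ge0 ?normal_pdf_ge0.
rewrite (_ : [set x | _] = `[0, +oo[%classic); last first.
  by apply/seteqP; split => x/=; rewrite in_itv/= andbT.
have -> : (\int[mu]_(x in `[0%R, +oo[) (`|x| * normal_pdf 0 1 x)%:E)%E =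
   (\int[mu]_(x in `[0%R, +oo[) (x * normal_pdf 0 1 x)%:E)%E.
  by apply: eq_integral => x; rewrite inE /= in_itv /= andbT => x0; rewrite ger0_norm.
have dF x : is_derive x 1 (fun x : R => - (normal_peak 1 * expR (- (x ^+ 2 / 2))))
   (x * normal_pdf 0 1 x).
  apply: is_derive_eq.
  by rewrite normal_pdf01E /GRing.scale /=; field.
rewrite (@ge0_continuous_FTC2y _ _ (fun x : R => - (normal_peak 1 * expR (- (x ^+ 2 / 2)))) _ 0) //.
- by rewrite expr0n /= mul0r oppr0 expR0 mulr1 -EFinB sub0r opprK -EFinM.
- by move=> x x0; rewrite mulr_ge0 ?normal_pdf_ge0.
- apply: continuous_subspaceT => x; apply: cvgM; first exact: cvg_id.
  by apply: continuous_normal_pdf; rewrite oner_eq0.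
- rewrite -oppr0 -(mulr0 (normal_peak 1)); apply: cvgN; apply: cvgM; first exact: cvg_cst.
  apply: (cvg_comp (fun x : R => x ^+ 2 / 2) (fun x => expR (- x))); last exact: cvgr_expR.
  by apply: gt0_cvgMly => //; exact: cvgr_expr2.
- by apply: cvg_at_right_filter; apply: cvgN; apply: cvgM; [exact: cvg_cst|exact: continuous_gauss].
- by move=> x _; rewrite derive1E; have [_ ->] := dF x.
Qed.

Lemma measurable_normR_normal : measurable_fun setT (fun x : R => `|x| * normal_pdf 0 1 x).
Proof. by apply: measurable_funM => //; exact: measurable_normal_pdf. Qed.

Lemma integral_expR_norm_normal t : 0 <= t -> t <= 2^-1 ->
  (\int[mu]_x (expR (t * `|x|) * normal_pdf 0 1 x)%:E <=
   (1 + t * (2 * normal_peak 1) + 24 * t ^+ 2)%:E)%E.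
Proof.
move=> t0 t2.
have f0 (m s x : R) : 0 <= normal_pdf m s x by exact: normal_pdf_ge0.
have mf m s : measurable_fun [set: measurableTypeR R] (fun x : R => (normal_pdf m s x)%:E).
  by apply/measurable_EFinP; exact: measurable_normal_pdf.
have mg : measurable_fun [set: measurableTypeR R] (fun x : R => (`|x| * normal_pdf 0 1 x)%:E).
  by apply/measurable_EFinP; exact: measurable_normR_normal.
apply: (@le_trans _ _ (\int[mu]_x ((normal_pdf 0 1 x)%:E +
   t%:E * (`|x| * normal_pdf 0 1 x)%:E + (24 * t ^+ 2)%:E * (normal_pdf 0 (Num.sqrt 2) x)%:E))%E).
  apply: ge0_le_integral => //.
  - by move=> x _; rewrite lee_fin mulr_ge0 ?expR_ge0.
  - apply/measurable_EFinP/measurable_funM; last exact: measurable_normal_pdf.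
    apply: measurableT_comp => //; apply: measurable_funM => //.
  - apply: emeasurable_funD; first apply: emeasurable_funD => //.
    + exact: measurable_funeM.
    + exact: measurable_funeM.
  - by move=> x _; rewrite -!EFinM -!EFinD lee_fin expR_normal_le.
rewrite ge0_integralD //; first last.
- exact: measurable_funeM.
- by move=> x _; rewrite -EFinM lee_fin mulr_ge0 // mulr_ge0 ?sqr_ge0.
- by apply: emeasurable_funD => //; exact: measurable_funeM.
- by move=> x _; rewrite -EFinM -EFinD lee_fin addr_ge0 // !mulr_ge0.
rewrite ge0_integralD //; first last.
- exact: measurable_funeM.
- by move=> x _; rewrite -EFinM lee_fin !mulr_ge0.
- by move=> x _; rewrite lee_fin.
rewrite !ge0_integralZl //; first last.
- by move=> x _; rewrite lee_fin mulr_ge0.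
- by rewrite lee_fin mulr_ge0 ?sqr_ge0.
- by move=> x _; rewrite lee_fin.
by rewrite !integral_normal_pdf integral_norm_normal -!EFinM -!EFinD lee_fin mulr1.
Qed.

(** This is tanh(|beta x| / 2). *)
Definition influence_of (beta x : R) : R := `|1 - expR (beta * x)| / (1 + expR (beta * x)).

(** Equivalent to tanh(x/2) <= x/2. The difference of the two sides vanishes at 0 and has derivative
    [1 - expR y * (1 - y)], nonnegative since [1 - y <= expR (- y)]. *)
Lemma pade_expR x : 0 <= x -> expR x * (2 - x) <= 2 + x.
Proof.
move=> x0; have [->|xn0] := eqVneq x 0; first by rewrite expR0; lra.
have xp : 0 < x by rewrite lt_def xn0.
pose f (y : R) : R := 2 + y - expR y * (2 - y).
have df (y : R) : is_derive y 1 f (1 - expR y * (1 - y)).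
  by apply: is_derive_eq; rewrite /GRing.scale /=; ring.
have : f 0 <= f x.
  apply: (@ger0_derive1_le_cc _ f 0 x); rewrite ?in_itv /= ?lexx //.
  - move=> y _; rewrite derive1E; have [_ ->] := df y.
    have := expR_ge1Dx (- y); rewrite expRN => h.
    have ey := expR_gt0 y.
    by rewrite subr_ge0 mulrC -ler_pdivlMr // mul1r.
  - by apply: continuous_subspaceT => y; apply/differentiable_continuous/derivable1_diffP; have [] := df y.
  - by rewrite x0.
by rewrite /f expR0; lra.
Qed.

Lemma influence_of_ge0 beta x : 0 <= influence_of beta x.
Proof. by rewrite divr_ge0 // addr_ge0 ?expR_ge0. Qed.

Lemma influence_of_lt1 beta x : influence_of beta x < 1.
Proof.
have e0 := expR_gt0 (beta * x).
rewrite /influence_of ltr_pdivrMr ?addr_gt0 // mul1r ltr_norml; apply/andP; split; lra.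
Qed.

Lemma influence_of_le beta x : 0 <= beta -> influence_of beta x <= beta / 2 * `|x|.
Proof.
move=> b0.
have -> : beta / 2 * `|x| = `|beta * x| / 2 by rewrite normrM (ger0_norm b0); ring.
have main y : 0 <= y -> (expR y - 1) / (1 + expR y) <= y / 2.
  move=> y0; have ey := expR_gt0 y; rewrite ler_pdivrMr ?addr_gt0 //.
  by have := pade_expR y0; lra.
rewrite /influence_of; move: (beta * x) => {}x.
have [x0|x0] := leP 0 x.
  rewrite (ger0_norm x0) ler0_norm ?opprB ?main //.
  by rewrite subr_le0 -[leLHS]expR0 ler_expR.
have := main (- x); rewrite oppr_ge0 (ltW x0) => /(_ isT); rewrite (ltr0_norm x0); apply: le_trans.
rewrite ger0_norm; last by rewrite subr_ge0 -[leRHS]expR0 ler_expR ltW.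
rewrite expRN; have ex := expR_gt0 x; rewrite le_eqVlt; apply/orP; left; apply/eqP; field.
by rewrite !gt_eqF // addr_gt0.
Qed.

Lemma measurable_influence_of beta : measurable_fun setT (influence_of beta).
Proof.
have me : measurable_fun setT (fun x : R => expR (beta * x)).
  by apply: measurableT_comp => //; exact: measurable_funM.
apply: measurable_funM; first by apply: measurableT_comp => //; exact: measurable_funB.
apply: continuous_measurable_fun => x; apply: cvgV.
  by rewrite gt_eqF // addr_gt0 // expR_gt0.
apply: cvgD; first exact: cvg_cst.
apply: (@continuous_comp _ _ _ (fun x : R => beta * x) expR); last exact: continuous_expR.
by apply: cvgM; [exact: cvg_cst|exact: cvg_id].
Qed.

Definition level_set (beta : R) (K : nat) (k : 'I_K) : set R :=
  [set x | k%:R <= K%:R * influence_of beta x < k.+1%:R].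

Lemma measurable_level_set beta K (k : 'I_K) : measurable (@level_set beta K k).
Proof.
have mK : measurable_fun setT (fun x => K%:R * influence_of beta x).
  by apply: measurable_funM => //; exact: measurable_influence_of.
have -> : @level_set beta K k = setT `&` (fun x => K%:R * influence_of beta x) @^-1`
    [set` `[k%:R, k.+1%:R[].
  by rewrite setTI; apply/seteqP; split => x; rewrite /level_set /= in_itv.
exact: mK.
Qed.

(** The influence is strictly below 1, so the integer part of its [K]-fold is an index below [K]. *)
Lemma level_exists beta K x : (0 < K)%N -> exists k : 'I_K, level_set beta k x.
Proof.
move=> K0.
have v0 : 0 <= K%:R * influence_of beta x by rewrite mulr_ge0 ?influence_of_ge0.
have vK : K%:R * influence_of beta x < K%:R.
  by rewrite gtr_pMr ?ltr0n // influence_of_lt1.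
have kK : (Num.truncn (K%:R * influence_of beta x) < K)%N by rewrite truncn_lt_nat.
by exists (Ordinal kK); rewrite /level_set /= truncn_itv.
Qed.

Lemma level_unique beta K (k k' : 'I_K) x : level_set beta k x -> level_set beta k' x -> k = k'.
Proof.
move=> kx k'x; apply: val_inj => /=.
by rewrite -(truncn_def kx) -(truncn_def k'x).
Qed.

Definition level_prob (beta : R) K (k : 'I_K) : R := fine (normal_prob 0 1 (level_set beta k)).

Lemma level_probE beta K (k : 'I_K) :
  (level_prob beta k)%:E = normal_prob 0 1 (level_set beta k).
Proof.
by rewrite fineK // fin_num_measure //; exact: measurable_level_set.
Qed.

Lemma level_prob_ge0 beta K (k : 'I_K) : 0 <= level_prob beta k.
Proof. by rewrite fine_ge0. Qed.

Lemma integral_levels beta K (h : R -> R) : (0 < K)%N -> (forall x, 0 <= h x) ->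
  measurable_fun setT h ->
  (\sum_(k < K) \int[mu]_(x in level_set beta k) (h x * normal_pdf 0 1 x)%:E =
   \int[mu]_x (h x * normal_pdf 0 1 x)%:E)%E.
Proof.
move=> K0 h0 mh.
have U : \big[setU/set0]_(k < K) level_set beta k = [set: measurableTypeR R].
  apply/seteqP; split => // x _; rewrite -bigcup_seq.
  by have [k kx] := level_exists beta x K0; exists k => //=; rewrite mem_index_enum.
rewrite -[in RHS]U ge0_integral_bigsetU //.
- by move=> k; exact: measurable_level_set.
- exact: index_enum_uniq.
- by move=> k k' _ _ [x [kx k'x]]; exact: level_unique kx k'x.
- apply: (@measurable_funTS _ _ (measurableTypeR R)).
  by apply/measurable_EFinP; apply: measurable_funM => //; exact: measurable_normal_pdf.
- by move=> x _; rewrite lee_fin mulr_ge0 ?normal_pdf_ge0.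
Qed.

Lemma level_prob_sum1 beta K : (0 < K)%N -> \sum_(k < K) level_prob beta k = 1.
Proof.
move=> K0; apply: EFin_inj; rewrite -sumEFin.
under eq_bigr do rewrite level_probE /normal_prob.
transitivity (\sum_(k < K) \int[mu]_(x in level_set beta k) (1 * normal_pdf 0 1 x)%:E)%E.
  by apply: eq_bigr => k _; apply: eq_integral => x _; rewrite mul1r.
rewrite (integral_levels beta (h := fun=> 1)) //.
by under eq_integral do rewrite mul1r; exact: integral_normal_pdf.
Qed.

(** On level [k] the value [(k + 1) / K] exceeds the influence by at most [1 / K], which costs
    [expR (t / K)]. The influence is at most [beta / 2] times the modulus of the coupling. *)
Lemma level_prob_exp beta K t : (0 < K)%N -> 0 <= beta -> 0 <= t -> beta / 2 * t <= 2^-1 ->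
  \sum_(k < K) level_prob beta k * expR (t * (k.+1%:R / K%:R)) <=
  expR (t / K%:R) *
  (1 + (beta / 2 * t) * (2 * normal_peak 1) + 24 * (beta / 2 * t) ^+ 2).
Proof.
move=> K0 b0 t0 bt; have K0' : 0 < K%:R :> R by rewrite ltr0n.
have bt0 : 0 <= beta / 2 * t by rewrite mulr_ge0 // divr_ge0.
rewrite -lee_fin -sumEFin EFinM.
have f0 (m s x : R) : 0 <= normal_pdf m s x by exact: normal_pdf_ge0.
have mfE : measurable_fun [set: measurableTypeR R] (fun x : R => (normal_pdf 0 1 x)%:E).
  by apply/measurable_EFinP; exact: measurable_normal_pdf.
pose h (x : R) : R := expR (beta / 2 * t * `|x|).
have mh : measurable_fun setT h.
  by apply: measurableT_comp => //; exact: measurable_funM.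
have mhE : measurable_fun [set: measurableTypeR R] (fun x : R => (h x * normal_pdf 0 1 x)%:E).
  by apply/measurable_EFinP; apply: measurable_funM => //; exact: measurable_normal_pdf.
apply: (@le_trans _ _ ((expR (t / K%:R))%:E *
   \int[mu]_x (h x * normal_pdf 0 1 x)%:E)%E); last first.
  by rewrite lee_wpmul2l ?lee_fin ?expR_ge0 // integral_expR_norm_normal.
rewrite -(@integral_levels beta K) //; last by move=> x; exact: expR_ge0.
rewrite ge0_sume_distrr; last first.
  by move=> k _; apply: integral_ge0 => x _; rewrite lee_fin mulr_ge0 ?expR_ge0.
apply: lee_sum => k _; rewrite mulrC EFinM level_probE /normal_prob.
have mk := @measurable_level_set beta K k.
rewrite -!ge0_integralZl //; first last.
- by move=> x _; rewrite lee_fin.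
- by apply: measurable_funTS.
- by move=> x _; rewrite lee_fin mulr_ge0 ?expR_ge0.
- by apply: measurable_funTS.
apply: ge0_le_integral => //.
- by move=> x _; rewrite -EFinM lee_fin mulr_ge0 ?expR_ge0.
- by apply: measurable_funeM; apply: measurable_funTS.
- by apply: measurable_funeM; apply: measurable_funTS.
move=> x /andP[kx _]; rewrite -!EFinM lee_fin [leRHS]mulrA.
apply: ler_wpM2r; [exact: f0|rewrite /h -expRD ler_expR].
have ib := influence_of_le x b0.
have -> : t * (k.+1%:R / K%:R) = t / K%:R + t * (k%:R / K%:R) by rewrite -natr1; field; lra.
rewrite lerD2l; have : k%:R / K%:R <= influence_of beta x by rewrite ler_pdivrMr // mulrC.
move=> /le_trans/(_ ib) kb.
by apply: le_trans (ler_wpM2l t0 kb) _; rewrite mulrA [t * _]mulrC.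
Qed.

End gaussian.

(** * Measurability of the event and a finite union bound *)

Section countable_measurability.
Context {disp : measure_display} {T : measurableType disp}.

Lemma measurable_exists (I : countType) (A : I -> set T) :
  (forall i, measurable (A i)) -> measurable [set w | exists i, A i w].
Proof.
move=> mA; have -> : [set w | exists i, A i w] = \bigcup_i A i.
  by apply/seteqP; split => w [i]; [exists i|exists i].
by apply: countable_bigcupT_measurable => //; exact: countableP.
Qed.

Lemma measurable_forall (I : countType) (A : I -> set T) :
  (forall i, measurable (A i)) -> measurable [set w | forall i, A i w].
Proof.
move=> mA; have -> : [set w | forall i, A i w] = ~` [set w | exists i, (~` A i) w].
  apply/seteqP; split => w /=; first by move=> Aw [i]; apply.
  by move=> nA i; apply: contrapT => nAi; apply: nA; exists i.
by apply/measurableC/measurable_exists => i; exact/measurableC/mA.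
Qed.

Lemma measurable_imply (Q : Prop) (A : set T) :
  measurable A -> measurable [set w | Q -> A w].
Proof.
move=> mA; have [q|nq] := pselect Q.
  by rewrite (_ : [set w | _] = A) //; apply/seteqP; split => w /= h; [exact: h|].
by rewrite (_ : [set w | _] = setT) //; apply/seteqP; split => w //= _ /nq.
Qed.

Lemma measurable_and (Q : Prop) (A : set T) :
  measurable A -> measurable [set w | Q /\ A w].
Proof.
move=> mA; have [q|nq] := pselect Q.
  by rewrite (_ : [set w | _] = A) //; apply/seteqP; split => w //= -[].
by rewrite (_ : [set w | _] = set0) //; apply/seteqP; split => w //= -[].
Qed.

Lemma measure_finite_union (R : realType) (P : probability T R) (I : eqType)
    (s : seq I) (A : I -> set T) (B : set T) :
  measurable B -> (forall i, measurable (A i)) ->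
  (forall w, B w -> exists2 i, i \in s & A i w) -> (P B <= \sum_(i <- s) P (A i))%E.
Proof.
move=> mB mA; elim: s B mB => [|i s IH] B mB BA.
  rewrite big_nil (_ : B = set0) ?measure0 //.
  by apply/seteqP; split => w // /BA[].
rewrite big_cons; apply: le_trans (leeD2l _ (IH (B `\` A i) _ _)); last 2 first.
- exact: measurableD.
- move=> w [/BA[j]]; rewrite inE => /predU1P[->//|js] Aj _.
  by exists j.
have mD : measurable (B `\` A i) by exact: measurableD.
apply: le_trans (measureU2 _ (mA i) mD).
apply: le_measure; rewrite ?inE //; first exact: measurableU.
by move=> w Bw; have [Aw|Aw] := pselect (A i w); [left|right].
Qed.

End countable_measurability.

Section measurable_event.
Context {disp : measure_display} {T : measurableType disp} {R : realType}.
Variables (P : probability T R) (n : nat) (d eps beta r l : R).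
Variables (X : {set 'I_n} -> {RV P >-> bool}) (J : {set 'I_n} -> {RV P >-> R}).

Lemma measurable_agg_influence (E : {set {set 'I_n}}) v :
  measurable_fun setT (fun w => agg_influence beta E (fun e => J e w) v).
Proof.
rewrite /agg_influence; under eq_fun do rewrite big_mkcond /=.
apply: measurable_sum => u; case: (adj E v u) => //.
rewrite (_ : (fun w => _) = influence_of beta \o J [set v; u]%SET) //.
by apply: measurableT_comp => //; exact: measurable_influence_of.
Qed.

Lemma measurable_path_weight (E : {set {set 'I_n}}) v s :
  measurable_fun setT (fun w => path_weight d eps beta E (fun e => J e w) v s).
Proof.
apply: measurable_prod => u _; apply: measurable_fun_ifT => //.
  by apply: measurable_fun_ler => //; exact: measurable_agg_influence.
by apply: measurable_funM => //; exact: measurable_agg_influence.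
Qed.

Lemma measurable_random_edges (E : {set {set 'I_n}}) :
  measurable [set w | random_edges X w = E].
Proof.
rewrite (_ : [set w | _] = [set w | forall e, [set w | (e \in random_edges X w) = (e \in E)] w]).
  apply: measurable_forall => e.
  rewrite (_ : [set w | _] = X e @^-1` [set b | ((#|e| == 2%N) && b) = (e \in E)]).
    exact: measurable_funPTI.
  by apply/seteqP; split => w /=; rewrite inE.
apply/seteqP; split => w /= h; first by move=> e; rewrite h.
by apply/finset.setP => e; exact: h.
Qed.

(** Once the random graph is fixed to one of its values [E], all quantifiers range over countable
    types and only the path weights still depend on the sample. *)
Lemma measurable_event_SB : measurable (event_SB d eps beta r l X J).
Proof.
have -> : event_SB d eps beta r l X J = [set w | forall p : 'I_n * seq 'I_n,
  [set w | forall E : {set {set 'I_n}}, [set w | random_edges X w <> E \/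
   [set w | simple_paths E r l p -> [set w | exists u, [set w | u \in p.1 :: p.2 /\
     [set w | forall s, [set w | is_path E u s -> [set w | (size s)%:R <= r ->
        [set w | path_weight d eps beta E (fun e => J e w) u s < 1] w] w] w] w] w] w] w] w] w].
  apply/seteqP; split => w /= h p.
    move=> E; have [<-|ne] := pselect (random_edges X w = E); last by left.
    right => ps; have [u up ub] := h p ps.
    by exists u; split.
  move=> ps; have [//|/(_ ps)[u [up ub]]] := h p (random_edges X w).
  by exists u.
apply: measurable_forall => p; apply: measurable_forall => E.
rewrite (_ : [set w | _] = ~` [set w | random_edges X w = E] `|`
   [set w | simple_paths E r l p -> [set w | exists u, [set w | u \in p.1 :: p.2 /\
     [set w | forall s, [set w | is_path E u s -> [set w | (size s)%:R <= r ->
        [set w | path_weight d eps beta E (fun e => J e w) u s < 1] w] w] w] w] w] w]) //.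
apply: measurableU; first exact/measurableC/measurable_random_edges.
apply: measurable_imply; apply: measurable_exists => u; apply: measurable_and.
apply: measurable_forall => s; do 2 apply: measurable_imply.
have := @measurable_path_weight E u s measurableT _ (measurable_itv `]-oo, 1[).
by rewrite setTI; congr measurable; apply/seteqP; split => w /=; rewrite in_itv.
Qed.

End measurable_event.

(** * From samples to configurations, and Markov's inequality *)

Section configuration_of_sample.
Context {disp : measure_display} {T : measurableType disp} {R : realType}.
Variables (P : probability T R) (n K : nat) (p d eps beta r l : R).
Variables (X : {set 'I_n} -> {RV P >-> bool}) (J : {set 'I_n} -> {RV P >-> R}).
Hypotheses (K_gt0 : (0 < K)%N) (p01 : 0 <= p <= 1) (XJ : EA_on_Gnp p X J).

Definition config_event (c : config n K) : set T :=
  [set w | forall e : vpair n, X (val e) w = (c e).1 /\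
                               level_set beta (c e).2 (J (val e) w)].

Lemma config_event_exists w : exists c, config_event c w.
Proof.
have /choice[k hk] : forall e : vpair n, exists k : 'I_K, level_set beta k (J (val e) w).
  by move=> e; exact: level_exists.
by exists [ffun e => (X (val e) w, k e)] => e; rewrite ffunE; split => //; exact: hk.
Qed.

Lemma measurable_config_event c : measurable (config_event c).
Proof.
rewrite (_ : config_event c = [set w | forall e : vpair n,
  (X (val e) @^-1` [set (c e).1] `&` J (val e) @^-1` level_set beta (c e).2) w]) //.
apply: measurable_forall => e; apply: measurableI; apply: measurable_funPTI => //.
exact: measurable_level_set.
Qed.

Lemma config_event_prob c :
  P (config_event c) = (config_prob p (@level_prob R beta K) c)%:E.
Proof.
have [XB JN indep] := XJ.
pose A (i : vpair n + vpair n) : set T := match i with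
  | inl e => X (val e) @^-1` [set (c e).1]
  | inr e => J (val e) @^-1` level_set beta (c e).2 end.
have -> : config_event c = \bigcap_(i in [set` [set: vpair n + vpair n]%SET]) A i.
  apply/seteqP; split => w /=; first by move=> h [] e _ /=; have [] := h e.
  move=> h e; split; first by apply: (h (inl e)); rewrite /= inE.
  by apply: (h (inr e)); rewrite /= inE.
rewrite indep; last first.
  move=> [] e _ /=.
    by exists [set (c e).1] => //; rewrite setTI.
  by exists (level_set beta (c e).2); rewrite ?setTI //; exact: measurable_level_set.
rewrite (eq_bigl xpredT) ?big_sumType /=; last by move=> i; rewrite inE.
rewrite /config_prob big_split /= EFinM -!prodEFin; congr (_ * _)%E.
  apply: eq_bigr => e _; have := XB e [set (c e).1].
  by rewrite /bernoulli_prob p01 fsbig_set1.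
apply: eq_bigr => e _; rewrite level_probE -(JN e) //.
exact: measurable_level_set.
Qed.

(** The first term covers light vertices. For a heavy one, [A ^+ m <= expR (m * A)], and the
    Chernoff factor [expR (lam * (A - (1 - eps / 2)))] is at least 1. *)
Lemma vertex_weight_le (m : nat) (lam : R) (A A' : R) :
  0 < eps -> eps < 1 -> 0 <= d -> 0 <= lam -> 0 <= A -> A <= A' ->
  (if A <= 1 - eps / 2 then 1 - eps / 4 else d * A) ^+ m <=
  (1 - eps / 4) ^+ m +
  d ^+ m * expR (- (lam * (1 - eps / 2))) * expR ((m%:R + lam) * A').
Proof.
move=> e0 e1 d0 lam0 A0 AA'.
have a0 : 0 <= 1 - eps / 4 by lra.
case: ifPn => [_|]; first by rewrite lerDl !mulr_ge0 ?expR_ge0 ?exprn_ge0.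
rewrite -ltNge => hA; rewrite -[leLHS]add0r lerD ?exprn_ge0 //.
rewrite exprMn -mulrA ler_wpM2l ?exprn_ge0 // -expRD.
apply: (@le_trans _ _ (expR (m%:R * A))).
  rewrite expRM_natl lerXn2r ?nnegrE ?expR_ge0 //.
  by have := expR_ge1Dx A; lra.
rewrite ler_expR.
have : m%:R * A <= m%:R * A' by rewrite ler_wpM2l.
have : lam * (1 - eps / 2) <= lam * A' by rewrite ler_wpM2l //; lra.
by rewrite mulrDl; lra.
Qed.

(** The neighbours [u] of [v] correspond to the present pairs [[set v; u]], and each influence is
    below the upper end of its level. *)
Lemma agg_influence_le c w v : config_event c w ->
  agg_influence beta (random_edges X w) (fun e => J e w) v <=
  config_agg (fun k : 'I_K => k.+1%:R / K%:R) c v.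
Proof.
move=> cw.
rewrite /agg_influence /config_agg.
pose E := random_edges X w.
pose f (e : {set 'I_n}) := influence beta (fun e => J e w) e.
have f0 e : 0 <= f e by exact: influence_of_ge0.
apply: (@le_trans _ _ (\sum_(e : vpair n | (v \in val e) && (c e).1) f (val e))); last first.
  apply: ler_sum => e _; have [_ /andP[_ le]] := cw e.
  by rewrite ler_pdivlMr ?ltr0n // mulrC ltW.
rewrite (eq_bigl (fun e : vpair n => (v \in val e) && (val e \in E))); last first.
  move=> e; rewrite /E inE (valP e) /=; have [-> _] := cw e; by [].
rewrite -(big_sub_cond (fun e : {set 'I_n} => #|e| == 2%N)
   (fun e => (v \in e) && (e \in E))) /=.
rewrite -(big_imset (h := fun u => [set v; u]%SET) (A := [pred u | adj E v u]) f) /=.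
  rewrite [leRHS](bigID (fun e => e \in [set [set v; x]%SET | x in adj E v]%SET)) /=.
  rewrite -[leLHS]addr0 lerD ?sumr_ge0 //.
  rewrite le_eqVlt; apply/orP; left; apply/eqP; apply: eq_bigl => e.
  apply/idP/idP => [|/andP[]//].
  move=> he; rewrite he andbT; case/imsetP: he => u.
  rewrite inE => /andP[vu eE] ->; apply/and3P; split => //; last by rewrite !inE eqxx.
  by rewrite -topredE /= cards2 vu.
move=> u u'; rewrite !inE => /andP[vu _] /andP[vu' _] Eu.
have : u \in [set v; u']%SET by rewrite -Eu !inE eqxx orbT.
by rewrite !inE eq_sym (negbTE vu) => /eqP.
Qed.

(** The caterpillar of a path without block vertices is one of the summands. Its product dominates
    the [m]-th power of a product of weights that is at least 1, and all other summands are
    nonnegative. *)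
Lemma fail_caterpillar_sum (m : nat) (lam : R) c w :
  0 < eps -> eps < 1 -> 0 <= d -> 0 <= lam -> 0 <= r ->
  config_event c w -> ~ event_SB d eps beta r l X J w ->
  1 <= caterpillar_sum (fun k : 'I_K => k.+1%:R / K%:R) (m%:R + lam)
         ((1 - eps / 4) ^+ m) (d ^+ m * expR (- (lam * (1 - eps / 2)))) l c.
Proof.
move=> e0 e1 d0 lam0 r0 cw /existsNP[p0 /not_implyP[sp nb]].
set al := (1 - eps / 4) ^+ m; set ga := d ^+ m * _.
have al0 : 0 <= al by rewrite exprn_ge0 //; lra.
have ga0 : 0 <= ga by rewrite mulr_ge0 ?exprn_ge0 ?expR_ge0.
pose E := random_edges X w.
have [|t [ut tE Et [t0 lt tc] Mt]] := nonblock_caterpillar (d := d) (eps := eps) (beta := beta)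
  (J := fun e => J e w) r0 sp.
  by move=> u up bu; apply: nb; exists u.
have tn : (size t < n.+1)%N.
  have := max_card (mem (verts t)).
  by rewrite (card_uniqP ut) card_ord /verts size_map ltnS.
have term0 (N : 'I_n.+1) (s : N.-tuple (item 'I_n)) : 0 <= (config_fits c s)%:R *
      \prod_(i <- s | selected i) (al + ga * expR ((m%:R + lam) *
        config_agg (fun k : 'I_K => k.+1%:R / K%:R) c i.1)).
  by rewrite mulr_ge0 // prodr_ge0 // => i _; rewrite addr_ge0 // mulr_ge0 ?expR_ge0.
rewrite /caterpillar_sum (bigD1 (Ordinal tn)) /=; last by rewrite t0 lt.
rewrite (bigD1 (in_tuple t)) /=; last by rewrite ut tc.
have -> : config_fits c t.
  apply/forallP => e.
  have eE : (val e \in E) = (c e).1.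
    by rewrite /E inE (valP e) /=; have [-> _] := cw e.
  rewrite -eE; apply/andP; split; apply/implyP; first exact: tE.
  move=> /andP[eE' /fintype.subsetP et].
  have /cards2P[u [v [uv Ee]]] := valP e.
  rewrite Ee; apply: Et.
  - by apply: et; rewrite Ee !inE eqxx.
  - by apply: et; rewrite Ee !inE eqxx orbT.
  - by rewrite /adj /= uv -Ee.
rewrite mul1r -!addrA -[leLHS]addr0 lerD //; last first.
  apply: addr_ge0; apply: sumr_ge0 => i _; first exact: (term0 (Ordinal tn)).
  by apply: sumr_ge0 => s _; exact: (term0 i).
apply: (@le_trans _ _ (\prod_(i <- t | selected i)
   vertex_weight d eps beta E (fun e => J e w) i.1 ^+ m)).
  by rewrite prodrXl exprn_ege1.
apply: ler_prod => i _.
have A0 : 0 <= agg_influence beta E (fun e => J e w) i.1.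
  by apply: sumr_ge0 => u _; exact: influence_of_ge0.
apply/andP; split.
  rewrite exprn_ge0 // /vertex_weight; case: ifP => _; first by lra.
  by rewrite mulr_ge0.
by apply: vertex_weight_le => //; exact: agg_influence_le.
Qed.

(** Markov's inequality in finite form: failure is covered by the events of those configurations
    whose sum is at least 1. *)
Lemma fail_prob_le (m : nat) (lam : R) :
  0 < eps -> eps < 1 -> 0 <= d -> 0 <= lam -> 0 <= r ->
  (P (~` event_SB d eps beta r l X J) <=
   (\sum_(c : config n K) config_prob p (@level_prob R beta K) c *
     caterpillar_sum (fun k : 'I_K => k.+1%:R / K%:R) (m%:R + lam)
         ((1 - eps / 4) ^+ m) (d ^+ m * expR (- (lam * (1 - eps / 2)))) l c)%:E)%E.
Proof.
move=> e0 e1 d0 lam0 r0.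
pose F (c : config n K) := caterpillar_sum (fun k : 'I_K => k.+1%:R / K%:R) (m%:R + lam)
         ((1 - eps / 4) ^+ m) (d ^+ m * expR (- (lam * (1 - eps / 2)))) l c.
have F0 c : 0 <= F c.
  apply: sumr_ge0 => N _; apply: sumr_ge0 => t _; rewrite mulr_ge0 // prodr_ge0 // => i _.
  by rewrite addr_ge0 ?mulr_ge0 ?expR_ge0 ?exprn_ge0 //; lra.
pose s := [seq c <- index_enum (config n K) | 1 <= F c].
have mB : measurable (~` event_SB d eps beta r l X J).
  by apply: measurableC; exact: measurable_event_SB.
have := @measure_finite_union _ _ _ P _ s config_event _ mB measurable_config_event.
move=> /(_ _)/le_trans; apply.
  move=> w nw; have [c cw] := config_event_exists w.
  by exists c => //; rewrite mem_filter mem_index_enum andbT; exact: fail_caterpillar_sum cw nw.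
under eq_bigr do rewrite config_event_prob.
rewrite sumEFin lee_fin big_filter [leRHS](bigID (fun c => 1 <= F c)) /=.
rewrite -[leLHS]addr0 lerD //; last first.
  apply: sumr_ge0 => c _; rewrite mulr_ge0 // config_prob_ge0 // => k.
  exact: level_prob_ge0.
apply: ler_sum => c Fc; rewrite ler_peMr // config_prob_ge0 // => k.
exact: level_prob_ge0.
Qed.

End configuration_of_sample.

(** * Choice of the parameters and conclusion *)

Section parameters.
Variable R : realType.

(** Here [beta_c] enters: [beta / 2] times the mean [2 * normal_peak 1] of |J| is at most
    [(1 - eps) / d]. The quadratic constant comes from [24 * (2 * pi) / 4 <= 48]; [3 * t <= d] and
    [Num.sqrt (2 * pi) <= 3] ensure [beta / 2 * t <= 1/2]. *)
Lemma level_prob_exp_beta_c (eps d beta t : R) (K : nat) : 0 < eps -> eps < 1 -> 0 < d ->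
  0 < beta -> beta <= (1 - eps) * beta_c d -> (0 < K)%N -> 0 <= t -> 3 * t <= d ->
  \sum_(k < K) level_prob beta k * expR (t * (k.+1%:R / K%:R)) <=
  expR (t / K%:R) * (1 + (1 - eps) * (t / d) + 48 * (t / d) ^+ 2).
Proof.
move=> e0 e1 d0 b0 bc K0 t0 td.
have sp0 : 0 < Num.sqrt (2 * pi) :> R by rewrite sqrtr_gt0 mulr_gt0 ?pi_gt0.
have sp2 : Num.sqrt (2 * pi) ^+ 2 <= 8 :> R.
  by rewrite sqr_sqrtr ?mulr_ge0 ?pi_ge0 //; have := @pihalf_lt2 R; lra.
have sp3 : Num.sqrt (2 * pi) <= 3 :> R.
  by rewrite -(@ler_pXn2r _ 2) ?nnegrE ?ltW //; lra.
have pk : normal_peak 1 = (Num.sqrt (2 * pi))^-1 :> R.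
  by rewrite /normal_peak expr1n mul1r mulr_natl.
set S := Num.sqrt (2 * pi) in sp0 sp2 sp3 pk.
have x0 : 0 <= t / d by rewrite divr_ge0 // ltW.
have bt : beta / 2 * t <= (1 - eps) * S / 2 * (t / d).
  have -> : (1 - eps) * S / 2 * (t / d) = ((1 - eps) * beta_c d) / 2 * t.
    by rewrite /beta_c -/S; field; rewrite gt_eqF.
  by rewrite ler_wpM2r // ler_wpM2r.
have x3 : 3 * (t / d) <= 1 by rewrite mulrA ler_pdivrMr // mul1r.
have bt0 : 0 <= beta / 2 * t by rewrite !mulr_ge0 ?invr_ge0 // ltW.
have bt1 : beta / 2 * t <= S / 2 * (t / d).
  apply: le_trans bt _; rewrite ler_wpM2r // ler_wpM2r // ler_piMl // ?ltW //; lra.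
apply: le_trans (level_prob_exp K0 (ltW b0) t0 _) _.
  by apply: le_trans bt1 _; nra.
rewrite ler_wpM2l ?expR_ge0 // pk; apply: lerD; first apply: lerD => //.
  apply: (@le_trans _ _ ((1 - eps) * S / 2 * (t / d) * (2 * S^-1))).
    by rewrite ler_wpM2r // mulr_ge0 // invr_ge0 ltW.
  by rewrite le_eqVlt; apply/orP; left; apply/eqP; field; rewrite !gt_eqF.
apply: (@le_trans _ _ (24 * (S / 2 * (t / d)) ^+ 2)).
  by rewrite ler_wpM2l // lerXn2r // nnegrE mulr_ge0 // divr_ge0 // ltW.
rewrite !exprMn; have : 0 <= t ^+ 2 * d^-1 ^+ 2 by rewrite mulr_ge0 ?sqr_ge0.
by move: (t ^+ 2 * d^-1 ^+ 2) sp2 => y; move: (S ^+ 2) => s; nra.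
Qed.

Lemma expR_le1D2x (x : R) : 0 <= x -> x <= 2^-1 -> expR x <= 1 + 2 * x.
Proof.
move=> x0 x1; have e0 := expR_gt0 x.
have : (1 - x) * expR x <= 1.
  by rewrite -ler_pdivlMr // mul1r -expRN; exact: expR_ge1Dx.
nra.
Qed.

Lemma small_quadratic_le1 (x v : R) :
  0 <= x -> x <= 2^-1 ^+ 8 -> v <= x -> v + 48 * x ^+ 2 <= 1.
Proof.
move=> x0 x1 vx.
have : x ^+ 2 <= 2^-1 ^+ 8 * x by rewrite expr2 ler_wpM2r.
lra.
Qed.

Lemma small_moment_le2 (x v y : R) :
  0 <= x -> x <= 2^-1 ^+ 7 -> 0 <= v -> v <= x -> y <= 2^-1 ->
  (1 + y) * (1 + v + 48 * x ^+ 2) <= 2.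
Proof.
move=> x0 x1 v0 vx y2.
have : x ^+ 2 <= 2^-1 ^+ 7 * x by rewrite expr2 ler_wpM2r.
have : 0 <= x ^+ 2 by exact: sqr_ge0.
move=> h1 h2.
have : 0 <= 1 + v + 48 * x ^+ 2 <= 4 / 3 by lra.
move: (1 + v + _) => w; nra.
Qed.

Section large_degree.
Variables (eps z : R).
Hypotheses (eps_gt0 : 0 < eps) (eps_lt1 : eps < 1) (z_large : 2 ^+ 17 <= eps ^+ 2 * z).

Let d : R := z ^+ 16.
(** [m] is the power to which weights are raised, [h] the exponential tilt against heavy vertices,
    [lam] the resulting total exponent, and [u ^+ 2] the target cost of a selected vertex. *)
Let m : nat := Num.truncn (z ^+ 14).
Let h : R := eps * d / 2 ^+ 9.
Let lam : R := m%:R + h.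
Let u : R := expR (- (eps * z ^+ 14 / 2 ^+ 5)).

Lemma eps_z_large : 2 ^+ 17 <= eps * z.
Proof.
have e2 : 0 < eps ^+ 2 by rewrite exprn_gt0.
have z0 : 0 < z by rewrite -(pmulr_rgt0 _ e2); apply: lt_le_trans z_large; rewrite exprn_gt0.
apply: le_trans z_large _; rewrite ler_pM2r // expr2 ler_piMr // ltW //.
Qed.

Lemma z_ge1 : 1 <= z.
Proof.
have z0 : 0 < z.
  by rewrite -(pmulr_rgt0 _ eps_gt0); apply: lt_le_trans eps_z_large; rewrite exprn_gt0.
have := eps_z_large; have : eps * z <= z by rewrite ler_piMl // ltW.
by lra.
Qed.

Lemma zX_le i j : (i <= j)%N -> z ^+ i <= z ^+ j.
Proof. by move=> ij; rewrite ler_weXn2l // z_ge1. Qed.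

Lemma zX_ge1 i : 1 <= z ^+ i.
Proof. by rewrite exprn_ege1 // z_ge1. Qed.

Lemma degree_gt0 : 0 < d.
Proof. exact: lt_le_trans ltr01 (zX_ge1 16). Qed.

Lemma degree_ge2 : 2 <= d.
Proof.
apply: (@le_trans _ _ z); last exact: (@zX_le 1).
have := eps_z_large; have : eps * z <= z by exact: ler_piMl (le_trans ler01 z_ge1) (ltW eps_lt1).
by lra.
Qed.

Lemma degree_le_exp : d <= expR (16 * z).
Proof.
rewrite /d expRM_natl; apply: lerXn2r; rewrite ?nnegrE ?expR_ge0 //.
  exact: le_trans ler01 z_ge1.
by have := expR_ge1Dx z; lra.
Qed.

Lemma m_le_h : m%:R <= h.
Proof.
apply: (@le_trans _ _ (z ^+ 14)).
  by rewrite truncn_le; apply: le_trans (zX_ge1 14).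
rewrite /h ler_pdivlMr ?exprn_gt0 // /d.
have -> : eps * z ^+ 16 = z ^+ 14 * (eps * z * z) by ring.
rewrite ler_wpM2l // ?(le_trans _ (zX_ge1 14)) //.
have := eps_z_large; have := z_ge1; move: (eps * z) => y; nra.
Qed.

Lemma m_lower : z ^+ 14 / 2 <= m%:R.
Proof.
have := truncnS_gt (z ^+ 14); rewrite -/m -natr1.
have : 1 <= z by exact: z_ge1.
have : z <= z ^+ 14 by exact: (@zX_le 1).
have := eps_z_large; have : eps * z <= z by exact: ler_piMl (le_trans ler01 z_ge1) (ltW eps_lt1).
by lra.
Qed.

Lemma m_upper : m%:R <= z ^+ 14.
Proof. by rewrite truncn_le; apply: le_trans (zX_ge1 14). Qed.

Lemma lam_le : lam <= eps * d / 2 ^+ 8.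
Proof. by have := m_le_h; rewrite /lam /h; lra. Qed.

Lemma h_ge0 : 0 <= h.
Proof. exact: le_trans (ler0n _ _) m_le_h. Qed.

Lemma lam_ge0 : 0 <= lam.
Proof. by rewrite addr_ge0 // h_ge0. Qed.

(** The light and the heavy term are each at most [expR (- (y / 8))]. In the heavy exponent the tilt
    gains [eps * h / 2]; the quadratic term takes 3/8 of [eps * h], and the remaining 1/8 pays for
    [d ^+ m] and the lower-order terms. *)
Lemma rho_le :
  (1 - eps / 4) ^+ m + d ^+ m * expR (- (h * (1 - eps / 2))) *
    expR ((1 - eps) * lam + 48 * lam ^+ 2 / d + 2) <= u ^+ 2.
Proof.
have z14 := zX_ge1 14; have z1 := z_ge1.
have ez := eps_z_large.
have d0 := degree_gt0.
have h0 := h_ge0.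
have a0 : 0 <= 1 - eps / 4 by move: eps_gt0 eps_lt1; lra.
set y := eps * z ^+ 14.
have y_large : 2 ^+ 17 <= y.
  apply: le_trans ez _; rewrite /y ler_pM2l //; exact: (@zX_le 1).
have t1 : (1 - eps / 4) ^+ m <= expR (- (y / 8)).
  apply: (@le_trans _ _ (expR (- (eps / 4)) ^+ m)).
    by rewrite lerXn2r ?nnegrE ?expR_ge0 //; have := expR_ge1Dx (- (eps / 4)).
  rewrite -expRM_natl ler_expR /y.
  have : eps / 4 * (z ^+ 14 / 2) <= eps / 4 * m%:R.
    by rewrite ler_wpM2l ?m_lower // divr_ge0 // ltW.
  by lra.
have t2 : d ^+ m * expR (- (h * (1 - eps / 2))) *
    expR ((1 - eps) * lam + 48 * lam ^+ 2 / d + 2) <= expR (- (y / 8)).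
  have dm : d ^+ m <= expR (16 * z ^+ 15).
    apply: (@le_trans _ _ (expR (16 * z) ^+ m)).
      by rewrite lerXn2r ?nnegrE ?expR_ge0 ?(ltW d0) ?degree_le_exp.
    rewrite -expRM_natl ler_expR exprS mulrCA ler_wpM2l //.
    by rewrite mulrC ler_wpM2l ?m_upper // (le_trans _ z1).
  apply: (@le_trans _ _ (expR (16 * z ^+ 15) * expR (- (h * (1 - eps / 2))) *
    expR ((1 - eps) * lam + 48 * lam ^+ 2 / d + 2))).
    by rewrite ler_wpM2r ?expR_ge0 // ler_wpM2r ?expR_ge0.
  rewrite -!expRD ler_expR.
  (* From [lam <= 2 * h] and [4 * h ^+ 2 = eps * h * d / 2 ^+ 7]. *)
  have lam2 : 48 * lam ^+ 2 / d <= 48 * (eps * h / 2 ^+ 7).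
    rewrite -mulrA ler_wpM2l // ler_pdivrMr //.
    have -> : eps * h / 2 ^+ 7 * d = (2 * h) ^+ 2 by rewrite /h; field.
    apply: lerXn2r; rewrite ?nnegrE.
    - exact: lam_ge0.
    - exact: mulr_ge0 (ler0n _ 2) h0.
    - by have := m_le_h; rewrite /lam; move: h => h'; lra.
  (* This fixes the constant in [z_large]: the claim reads
     [2 ^+ 17 * z ^+ 15 <= eps ^+ 2 * z ^+ 16]. *)
  have eh : 32 * z ^+ 15 <= eps * h / 8.
    rewrite /h /d ler_pdivlMr // mulrA ler_pdivlMr ?exprn_gt0 //.
    have -> : eps * (eps * z ^+ 16) = z ^+ 15 * (eps ^+ 2 * z) by ring.
    have := z_large; have := zX_ge1 15; move: (z ^+ 15) (eps ^+ 2 * z) => a b; nra.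
  have m1 := m_upper.
  have z15 : z ^+ 14 <= z ^+ 15 by exact: zX_le.
  have y14 : y <= z ^+ 14 by exact: ler_piMl (le_trans ler01 z14) (ltW eps_lt1).
  have em : 0 <= eps * m%:R by rewrite mulr_ge0 // ltW.
  have eh0 : 0 <= eps * h by rewrite mulr_ge0 // ltW.
  by move: lam2 eh em eh0; rewrite /lam; lra.
apply: le_trans (lerD t1 t2) _.
rewrite /u -expRM_natl.
have -> : - (y / 8) = 2%:R * - (y / 2 ^+ 5) + - (y / 2 ^+ 4) by field.
rewrite expRD -mulrDr ler_piMr ?expR_ge0 //.
have := expR_ge1Dx (y / 2 ^+ 4); have ey := expR_gt0 (y / 2 ^+ 4).
rewrite expRN => hy.
have -> : (expR (y / 2 ^+ 4))^-1 + (expR (y / 2 ^+ 4))^-1 = 2 / expR (y / 2 ^+ 4) by ring.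
by rewrite ler_pdivrMr // mul1r; lra.
Qed.

(** The left side is the ratio of the series over N: [4 * n * u] for an item times [2 * d / n] for
    an edge. *)
Lemma growth_factor_le : 8 * d * u <= expR (- (z ^+ 8 * (z ^+ 4 + 3))).
Proof.
have z1 := z_ge1; have z12 := zX_ge1 12.
have dz := degree_le_exp.
have e8 : 8 <= expR 8 :> R by have := expR_ge1Dx (8 : R); lra.
apply: (@le_trans _ _ (expR 8 * expR (16 * z) * u)).
  by rewrite ler_wpM2r ?expR_ge0 // ler_pM // ltW // degree_gt0.
rewrite /u -!expRD ler_expR.
(* 28 = 8 + 16 + 1 + 3 collects the coefficients of 1, [z], [z ^+ 12] and [z ^+ 8], each power being
   at most [z ^+ 12]. *)
have : 28 * z ^+ 12 <= eps * z ^+ 14 / 2 ^+ 5.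
  rewrite ler_pdivlMr ?exprn_gt0 //.
  have -> : eps * z ^+ 14 = z ^+ 12 * (eps * z * z) by ring.
  have : 2 ^+ 17 <= eps * z * z by have := eps_z_large; move: (eps * z) => a; nra.
  by move: (eps * z * z) (z ^+ 12) z12 => a b; nra.
have : z <= z ^+ 12 by exact: (@zX_le 1).
have : z ^+ 8 <= z ^+ 12 by exact: zX_le.
have -> : z ^+ 8 * (z ^+ 4 + 3) = z ^+ 12 + 3 * z ^+ 8 by ring.
by lra.
Qed.

Lemma sqrt_degree : Num.sqrt d = z ^+ 8.
Proof.
rewrite /d (_ : z ^+ 16 = (z ^+ 8) ^+ 2); last by rewrite -exprM.
by rewrite sqrtr_sqr ger0_norm // (le_trans ler01 (zX_ge1 8)).
Qed.

(** As N is at least ln n / z^8, each term is at most n times n^(-(z^4 + 3)). There are at most n +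
    1 terms, and n(n + 1) <= n^3 uses up the 3. Finally z^4 = d^(1/4) and 10/75 <= 1/4. *)
Lemma caterpillar_series_le (n : nat) : d <= n%:R ->
  \sum_(N < n.+1 | (0 < N)%N && (ln n%:R / Num.sqrt d <= N%:R))
    (4 * n%:R * u) ^+ N * (d / n%:R * 2) ^+ N.-1 <= n%:R `^ (- (d `^ (10 / 75))).
Proof.
move=> dn; have d0 := degree_gt0; have z1 := z_ge1.
have d1 : 1 <= d by exact: zX_ge1.
have n2 : 2 <= n%:R :> R := le_trans degree_ge2 dn.
have n0 : 0 < n%:R :> R by lra.
have u0 : 0 <= u by exact: expR_ge0.
set c := expR (- ((z ^+ 4 + 3) * ln n%:R)).
have term (N : 'I_n.+1) : (0 < N)%N && (ln n%:R / Num.sqrt d <= N%:R) ->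
    (4 * n%:R * u) ^+ N * (d / n%:R * 2) ^+ N.-1 <= n%:R * c.
  case: N => -[|N] //= _; rewrite sqrt_degree => lN.
  have -> : (4 * n%:R * u) ^+ N.+1 * (d / n%:R * 2) ^+ N = n%:R * (4 * u * (8 * d * u) ^+ N).
    rewrite exprS -mulrA -exprMn.
    have -> : 4 * n%:R * u * (d / n%:R * 2) = 8 * d * u by field; rewrite gt_eqF.
    by ring.
  have x0 : 0 <= 8 * d * u by exact: mulr_ge0 (mulr_ge0 (ler0n _ 8) (ltW d0)) u0.
  apply: ler_wpM2l; first exact: ltW.
  apply: (@le_trans _ _ ((8 * d * u) ^+ N.+1)).
    rewrite exprS; apply: ler_wpM2r; first exact: exprn_ge0.
    by apply: ler_wpM2r => //; move: (d) d1 => a; lra.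
  apply: (@le_trans _ _ (expR (- (z ^+ 8 * (z ^+ 4 + 3))) ^+ N.+1)).
    apply: lerXn2r; rewrite ?nnegrE ?expR_ge0 //; last exact: growth_factor_le.
  rewrite -expRM_natl ler_expR mulrN lerN2.
  rewrite mulrA [leRHS]mulrC ler_wpM2l ?addr_ge0 //.
    exact: le_trans ler01 (zX_ge1 4).
  by rewrite -ler_pdivrMr // (lt_le_trans ltr01 (zX_ge1 8)).
apply: (le_trans (ler_sum _ term)).
apply: (@le_trans _ _ (\sum_(N < n.+1) n%:R * c)).
  rewrite [leRHS](bigID (fun N : 'I_n.+1 => (0 < N)%N && (ln n%:R / Num.sqrt d <= N%:R))) /=.
  by rewrite lerDl sumr_ge0 // => N _; rewrite mulr_ge0 ?expR_ge0.
rewrite sumr_const card_ord -[leLHS]mulr_natl.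
have -> : n.+1%:R = n%:R + 1 :> R by rewrite natr1.
have lnn : 0 <= ln n%:R :> R by rewrite ln_ge0 //; lra.
have powc : d `^ (10 / 75) <= z ^+ 4.
  have -> : z ^+ 4 = d `^ (1 / 4).
    rewrite /d -powR_mulrn ?(le_trans ler01 z1) // -powR_mulrn ?(le_trans ler01 z1) //.
    by rewrite -powRrM; congr (_ `^ _); field.
  by apply: ler_powR => //; lra.
have Ep (a : R) : n%:R `^ a = expR (a * ln n%:R) :> R by rewrite /powR gt_eqF.
apply: (@le_trans _ _ (n%:R ^+ 3 * c)).
  rewrite mulrA ler_wpM2r ?expR_ge0 //; move: (n%:R) n2 => x; nra.
have -> : n%:R ^+ 3 = expR (3 * ln n%:R) :> R by rewrite expRM_natl lnK // posrE.
rewrite Ep /c -expRD ler_expR.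
have : d `^ (10 / 75) * ln n%:R <= z ^+ 4 * ln n%:R by rewrite ler_wpM2r.
by move: (d `^ (10 / 75)) => v; lra.
Qed.

(** The power is at most [expR (d * (e - 1))]. With [e <= (1 + a) * (1 + 1 / d)] the exponent is at
    most [d * a + (1 + a)], and [a <= 1] yields the final 2. *)
Lemma crossing_factor_le (e : R) (n : nat) : d <= n%:R ->
  1 <= e -> e <= (1 + (1 - eps) * (lam / d) + 48 * (lam / d) ^+ 2) * (1 + 1 / d) ->
  (1 - d / n%:R + d / n%:R * e) ^+ n <= expR ((1 - eps) * lam + 48 * lam ^+ 2 / d + 2).
Proof.
move=> dn e1 eb; have d0 := degree_gt0.
have n0 : 0 < n%:R :> R by exact: lt_le_trans dn.
have p0 : 0 <= d / n%:R by rewrite divr_ge0 // ltW.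
apply: (@le_trans _ _ (expR (d / n%:R * (e - 1)) ^+ n)).
  apply: lerXn2r; rewrite ?nnegrE ?expR_ge0 //.
    have : 0 <= d / n%:R * (e - 1) by rewrite mulr_ge0 // subr_ge0.
    by move: (d / n%:R) p0 => p p0; lra.
  by have := expR_ge1Dx (d / n%:R * (e - 1)); move: (d / n%:R) => p; lra.
rewrite -expRM_natl ler_expR.
have -> : n%:R * (d / n%:R * (e - 1)) = d * (e - 1) by field; rewrite gt_eqF.
have x0 : 0 <= lam / d by rewrite divr_ge0 ?lam_ge0 // ltW.
have x1 : lam / d <= 2^-1 ^+ 8.
  rewrite ler_pdivrMr //; have := lam_le.
  have : eps * d <= d by exact: ler_piMl (ltW d0) (ltW eps_lt1).
  by move: (d) => a; move: lam => b; lra.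
have -> : (1 - eps) * lam + 48 * lam ^+ 2 / d = d * ((1 - eps) * (lam / d) + 48 * (lam / d) ^+ 2).
  by field; rewrite gt_eqF.
move: eb; set a := (1 - eps) * (lam / d) + 48 * (lam / d) ^+ 2.
rewrite -addrA -/a => eb.
have a1 : a <= 1.
  apply: (small_quadratic_le1 x0 x1).
  by apply: ler_piMl => //; move: eps_gt0; lra.
have : d * e <= d * ((1 + a) * (1 + 1 / d)) by rewrite ler_pM2l.
have -> : d * ((1 + a) * (1 + 1 / d)) = d * (1 + a) + (1 + a) by field; rewrite gt_eqF.
rewrite mulrBr mulr1 mulrDr mulr1.
by move: a1; move: (d * e) (d * a) (d : R) (a : R) => v w d' a'; lra.
Qed.

Lemma event_SB_prob_ge (beta : R) (n : nat) (disp : measure_display)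
    (T : measurableType disp) (P : probability T R)
    (X : {set 'I_n} -> {RV P >-> bool}) (J : {set 'I_n} -> {RV P >-> R}) :
  0 < beta -> beta <= (1 - eps) * beta_c d -> d <= n%:R -> EA_on_Gnp (d / n%:R) X J ->
  ((1 - n%:R `^ (- (d `^ (10 / 75))))%:E <=
   P (event_SB d eps beta (ln n%:R / Num.sqrt d) (ln n%:R / Num.sqrt d) X J))%E.
Proof.
move=> b0 bc dn XJ; set r := ln n%:R / Num.sqrt d.
have d0 := degree_gt0; have d1 : 1 <= d := zX_ge1 16.
have n1 : 1 <= n%:R :> R := le_trans d1 dn.
have n0 : 0 < n%:R :> R := lt_le_trans ltr01 n1.
have r0 : 0 <= r by rewrite divr_ge0 ?sqrtr_ge0 // ln_ge0.
have p01 : 0 <= d / n%:R <= 1.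
  by rewrite divr_ge0 ?(ltW d0) ?(ltW n0) //= ler_pdivrMr // mul1r.
have lam0 := lam_ge0; have lamd := lam_le.
have ed : eps * d <= d by exact: ler_piMl (ltW d0) (ltW eps_lt1).
(* Then [2 * lam / K <= 1 / (2 * d)], so rounding costs at most the factor [1 + 1 / d], even at the
   doubled exponent of tree edges. *)
pose K := (Num.truncn (4 * lam * d)).+1.
have K0 : 0 < K%:R :> R by rewrite ltr0n.
have expK : expR (2 * lam / K%:R) <= 1 + 1 / d.
  have Kl : 4 * lam * d <= K%:R by exact/ltW/truncnS_gt.
  have lK : 2 * lam / K%:R <= 2^-1 * (1 / d).
    rewrite ler_pdivrMr // mul1r -mulrA -ler_pdivrMl ?invr_gt0 // invrK mulrC.
    rewrite ler_pdivlMl //; apply: le_trans Kl.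
    by rewrite le_eqVlt; apply/orP; left; apply/eqP; ring.
  have dV : 1 / d <= 1 by rewrite ler_pdivrMr // mul1r.
  apply: (le_trans (expR_le1D2x _ _)).
  - by rewrite divr_ge0 ?mulr_ge0 // ltW.
  - by apply: le_trans lK _; lra.
  - by lra.
pose g (k : 'I_K) : R := k.+1%:R / K%:R.
pose q := @level_prob R beta K.
have e3 : 3 * (2 * lam) <= d by move: (d) d0 ed lamd => d'; move: (lam) => l'; lra.
have e3' : 3 * lam <= d by move: e3; move: (d) => d'; move: (lam) lam0 => l'; lra.
have B2 : \sum_k q k * expR (2 * lam * g k) <= 2.
  have := @level_prob_exp_beta_c eps d beta (2 * lam) K eps_gt0 eps_lt1 d0 b0 bc isT.
  move=> /(_ (mulr_ge0 (ler0n _ 2) lam0) e3) /le_trans; apply.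
  have y0 : 0 <= 2 * lam / d by exact: divr_ge0 (mulr_ge0 (ler0n _ 2) lam0) (ltW d0).
  have v0 : 0 <= (1 - eps) * (2 * lam / d).
    by apply: mulr_ge0 => //; rewrite subr_ge0; exact: ltW.
  apply: le_trans (ler_wpM2r _ expK) _.
    by apply: addr_ge0; [exact: addr_ge0|apply: mulr_ge0 => //; exact: sqr_ge0].
  apply: small_moment_le2 => //.
  - rewrite ler_pdivrMr //; move: (d) d0 ed lamd => d'; move: (lam) => l'; lra.
  - by apply: ler_piMl => //; rewrite gerBl; exact: ltW.
  - by rewrite ler_pdivrMr // mulrC ler_pdivlMr // mul1r degree_ge2.
have D_bound : (1 - d / n%:R + d / n%:R * \sum_k q k * expR (lam * g k)) ^+ n <=
    expR ((1 - eps) * lam + 48 * lam ^+ 2 / d + 2).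
  have lx0 : 0 <= lam / d by rewrite divr_ge0 ?(ltW d0).
  apply: crossing_factor_le => //.
    rewrite -(level_prob_sum1 beta (ltn0Sn _ : (0 < K)%N)); apply: ler_sum => k _.
    rewrite ler_peMr ?level_prob_ge0 // -expR0 ler_expR mulr_ge0 // divr_ge0 //.
  have := @level_prob_exp_beta_c eps d beta lam K eps_gt0 eps_lt1 d0 b0 bc isT lam0 e3'.
  move=> /le_trans; apply; rewrite mulrC ler_wpM2l //.
    rewrite -addrA addr_ge0 // addr_ge0 // mulr_ge0 ?sqr_ge0 //; move: eps_lt1; lra.
  apply: le_trans expK; rewrite ler_expR ler_wpM2r ?invr_ge0 ?(ltW K0) //.
  by move: (lam) lam0 => l'; lra.
have := @fail_prob_le _ _ _ P n K (d / n%:R) d eps beta r r X J isT p01 XJ m h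
  eps_gt0 eps_lt1 (ltW d0) h_ge0 r0.
rewrite -/q -/g -/lam => fail.
have series := @caterpillar_sum_expectation R n K (d / n%:R) q g p01 (@level_prob_ge0 R beta K)
  (level_prob_sum1 beta (ltn0Sn _)) _ lam 2 _ lam0 B2 D_bound
  ((1 - eps / 4) ^+ m) (d ^+ m * expR (- (h * (1 - eps / 2)))) _ _ r u (expR_ge0 _) _ rho_le.
have mS := measurable_event_SB d eps beta r r X J.
rewrite -[event_SB _ _ _ _ _ _ _]setCK probability_setC; last exact: measurableC.
rewrite EFinB leeB //; apply: le_trans fail _; rewrite lee_fin.
apply: le_trans (series _ _ _ _) (caterpillar_series_le dn).
- by move=> k; rewrite divr_ge0.
- by rewrite exprn_ge0 //; move: eps_gt0 eps_lt1; lra.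
- exact: mulr_ge0 (exprn_ge0 _ (ltW d0)) (expR_ge0 _).
- rewrite -[leRHS]expR0 ler_expR oppr_le0.
  by rewrite divr_ge0 ?exprn_ge0 // mulr_ge0 ?(ltW eps_gt0) // (le_trans ler01 (zX_ge1 14)).
Qed.

End large_degree.
End parameters.

Theorem theorem10p2 (R : realType) (eps : R) (eps_gt0 : 0 < eps) :
  exists2 d0 : R, 1 <= d0 &
    forall d beta : R, d0 <= d -> 0 < beta -> beta <= (1 - eps) * beta_c d ->
    forall n : nat, d <= n%:R ->
    forall (disp : measure_display) (T : measurableType disp)
      (P : probability T R) (X : {set 'I_n} -> {RV P >-> bool})
      (J : {set 'I_n} -> {RV P >-> R}),
    EA_on_Gnp (d / n%:R) X J ->
    let r := ln n%:R / Num.sqrt d in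
    let l := r in
    ((1 - n%:R `^ (- (d `^ (10 / 75))))%:E <= P (event_SB d eps beta r l X J))%E.
Proof.
(* For [eps >= 1] no positive [beta] is admissible. *)
have [eps_lt1|eps_ge1] := ltP eps 1; last first.
  exists 1 => // d beta d1 b0 bc; exfalso; move: b0; apply/negP; rewrite -leNgt.
  apply: le_trans bc _; rewrite mulr_le0_ge0 ?subr_le0 //.
  by rewrite divr_ge0 ?sqrtr_ge0 // (le_trans ler01 d1).
have e2 : 0 < eps ^+ 2 by rewrite exprn_gt0.
have c1 : 1 <= 2 ^+ 17 / eps ^+ 2.
  rewrite ler_pdivlMr // mul1r (@le_trans _ _ 1) ?exprn_ege1 ?exprn_ile1 // ?ltW //; lra.
(* Chosen so that the sixteenth root [z] of [d] satisfies [2 ^+ 17 <= eps ^+ 2 * z]. *)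
exists ((2 ^+ 17 / eps ^+ 2) ^+ 16); first by rewrite exprn_ege1.
move=> d beta dd0 b0 bc n dn disp T P X J XJ /=.
have d0 : 0 < d by apply: lt_le_trans dd0; rewrite exprn_gt0 // (lt_le_trans ltr01 c1).
have [z Ed z_large] : exists2 z, d = z ^+ 16 & 2 ^+ 17 <= eps ^+ 2 * z.
  have Ed : d = (d `^ (1 / 16)) ^+ 16.
    by rewrite -powR_mulrn ?powR_ge0 // -powRrM div1r mulVf ?powRr1 ?ltW.
  exists (d `^ (1 / 16)) => //.
  rewrite mulrC -ler_pdivrMr // -(@ler_pXn2r _ 16) ?nnegrE ?powR_ge0 -?Ed //.
  exact: le_trans ler01 c1.
by subst d; exact: event_SB_prob_ge.
Qed.
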